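(* Consider the one-dimensional DLA process $R(\cdot)$ with $R(0)=0$, and assume that the $N(i,0)$, $i\ge 1$, are i.i.d. with finite second moment $\mu_2=E\{N(i,0)^2\}>0$. Then, for all $\varepsilon>0$, there exist an $\eta=\eta(\varepsilon)>0$ and a $t_0=t_0(\varepsilon)$ such that $$P\left\{\frac{R(t)}{\sqrt t}>\eta\right\}\ge 1-\varepsilon\quad\text{for all }t\ge t_0.$$
   Context: One-dimensional DLA process. Fix a jump rate $D>0$. At time $0$ there are $N(i,0)\in\{0,1,2,\dots\}$ particles at each site $i\ge 1$ of $\mathbb{Z}$ (and no other particles), all colored white. All particles perform continuous-time symmetric simple random walks on $\mathbb{Z}$ with jump rate $D$, independent of each other and of the $N(i,0)$. The path of a particle is not influenced by its color. Put $\tau_0=0$ and $R(0)=0$. Inductively, given $\tau_k$ with $R(\tau_k)=k$ and no white particles in $[0,k]$ at time $\tau_k$, let $$\tau_{k+1}=\inf\{t>\tau_k:\text{ some white particle jumps to position }k\text{ at time }t\}$$ (such a jump is necessarily from $k+1$ to $k$). At time $\tau_{k+1}$, all white particles that were at $k+1$ at time $\tau_{k+1}-$ (including the one that jumped) change color to black and stay black forever, and $R$ increases to $k+1$. Black particles have no influence on $R$ or on other particles. Thus $R(t)=k$ for $\tau_k\le t<\tau_{k+1}$. *)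

(* Defs.v *)
From HB Require Import structures.
From mathcomp Require Import all_boot all_order all_algebra finmap.
From mathcomp Require Import all_classical all_reals all_analysis.
Import Order.TTheory GRing.Theory Num.Theory.
Import numFieldNormedType.Exports.

Set Implicit Arguments.
Unset Strict Implicit.
Unset Printing Implicit Defensive.

Local Open Scope classical_set_scope.
Local Open Scope ring_scope.

Section walk.
Context {R : realType}.
(* A nearest-neighbour walk started at x: it waits [hold n] before its n-th
   step (n = 0, 1, ...), which is +1 if [right n] and -1 otherwise. *)
Variables (hold : nat -> R) (right : nat -> bool) (x : int).

Definition jump_time (n : nat) : R := \sum_(m < n.+1) hold m.

Definition step (n : nat) : int := if right n then 1 else -1.

(* The sum has value 0 when infinitely many jumps occur up to time t, which is
   a null event for i.i.d. exponential holding times. *)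
Definition position (t : R) : int :=
  x + \sum_(n \in [set n | jump_time n <= t]) step n.

Definition position_left (t : R) : int :=
  x + \sum_(n \in [set n | jump_time n < t]) step n.

Lemma position_leftE (t : R) : finite_set [set n | jump_time n < t] ->
  \forall s \near t^'-, position s = position_left t.
Proof.
move=> /finite_seqP[F FE].
have : \forall s \near t^'-, forall n, n \in F -> jump_time n <= s.
  have : forall n, n \in F -> jump_time n < t.
    by move=> n nF; have : [set` F] n by []; rewrite -FE.
  elim: {FE} F => [|m F IH] mFt; first by near=> s.
  have mt : jump_time m < t by apply: mFt; rewrite mem_head.
  have {}IH := IH (fun n nF => mFt n (mem_behead (s := m :: F) nF)).
  near=> s => n; rewrite in_cons => /predU1P[->|nF].
    by near: s; exact: nbhs_left_ge.
  by move: nF; apply: (near IH s).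
move=> Fs; near=> s.
rewrite /position /position_left; congr (_ + _); apply: eq_fsbigl.
apply/seteqP; split => n /= ns.
  apply: (le_lt_trans ns); near: s; exact: nbhs_left_lt.
by have : [set` F] n by [rewrite -FE]; apply: (near Fs s).
Unshelve. all: by end_near. Qed.

End walk.

(* (i, j) is the j-th particle (j = 0, 1, ...) that starts at site i. *)
Definition particle : choiceType := (nat * nat)%type.

(* The aggregate as a function of the particles present ([init]) and of their
   trajectories: [X p t] is the position of p at time t, [Xl p t] its position
   just before time t. *)
Section aggregate.
Context {R : realType}.
Variables (init : set particle) (X Xl : particle -> R -> int).

Definition jumps_to (p : particle) (k : nat) (t : R) : Prop :=
  X p t = k%:Z /\ Xl p t <> k%:Z.

(* (tau_k, set of the particles that are white right after tau_k) *)
Fixpoint dla_state (k : nat) : \bar R * set particle :=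
  if k is k'.+1 then
    let: (tau, white) := dla_state k' in
    let tau' := ereal_inf [set t%:E | t in
      [set t | (tau < t%:E)%E /\ exists2 p, white p & jumps_to p k' t]] in
    (tau', white `\` [set p | exists2 t, tau' = t%:E & Xl p t = k%:Z])
  else (0%E, init).

Definition dla_tau (k : nat) : \bar R := (dla_state k).1.

(* R(t) = k for tau_k <= t < tau_{k+1}.  If tau_k <= t for all k, the value is
   +oo; this is a null event for i.i.d. initial counts with finite mean. *)
Definition dla_R (t : R) : \bar R :=
  ereal_sup [set (k%:R)%:E | k in [set k | (dla_tau k <= t%:E)%E]].

End aggregate.

Section randomness.
Context {d : measure_display} {T : measurableType d} {R : realType}.

Definition mutually_independent (P : probability T R) (I : choiceType)
    (D : set I) (F : I -> set (set T)) : Prop :=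
  forall (s : {fset I}) (A : I -> set T), [set` s] `<=` D ->
    (forall i, i \in s -> F i (A i)) ->
    P (\bigcap_(i in [set` s]) A i) = (\prod_(i <- s) P (A i))%E.

Definition sigma_of d' (T' : measurableType d') (X : T -> T') :
  set (set T) := preimage_set_system setT X measurable.

Variables (N : nat -> T -> nat) (hold : particle -> nat -> T -> R)
  (right : particle -> nat -> T -> bool).

(* index of an initial count N x, of a holding time hold p n, or of a step
   direction right p n; only those attached to sites >= 1 are relevant *)
Definition source : choiceType :=
  (nat + (particle * nat) + (particle * nat))%type.

Definition source_sigma (i : source) : set (set T) :=
  match i with
  | inl (inl x) => sigma_of (N x)
  | inl (inr (p, n)) => sigma_of (hold p n)
  | inr (p, n) => sigma_of (right p n)
  end.

Definition source_site (i : source) : nat :=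
  match i with
  | inl (inl x) => x
  | inl (inr (p, _)) => p.1
  | inr (p, _) => p.1
  end.

Definition dla_process (t : R) (w : T) : \bar R :=
  dla_R [set p | (0 < p.1)%N /\ (p.2 < N p.1 w)%N]
    (fun p => position (hold p ^~ w) (right p ^~ w) p.1%:Z)
    (fun p => position_left (hold p ^~ w) (right p ^~ w) p.1%:Z) t.

End randomness.

(* Main.v *)
Require Import Defs.
From HB Require Import structures.
From mathcomp Require Import all_boot all_order all_algebra finmap.
From mathcomp Require Import all_classical all_reals all_analysis.
From mathcomp Require Import measurable_realfun zify ring lra.
Import Order.TTheory GRing.Theory Num.Theory.
Import numFieldNormedType.Exports.

Set Implicit Arguments.
Unset Strict Implicit.
Unset Printing Implicit Defensive.

Local Open Scope classical_set_scope.
Local Open Scope ring_scope.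

(** Call the first particle of each occupied site its leader.  Every particle
whose path visits the origin by time t has almost surely been absorbed by then.  Of the
leaders starting in [1, M] with M of order sqrt t, a positive fraction visits
the origin by time t: they are independent, and each of them does so with
probability bounded below ([pr_reaches_origin], [chebyshev_count]).  If the process
has not gone beyond stage K by time t, then K stages have swallowed of the order
of M leaders; the point is that K stages swallow at most 3K leaders on average.

A leader q is absorbed in one of two ways.  Either its own jump ends the stage;
almost surely no two leaders do this at the same stage, so at most K leaders are
absorbed in this way ([sum_jumps_before_le]).  Or q merely stands on the site
that is being absorbed when something else ends the stage.  In the second case q
has influenced nothing so far: the stage times up to then are those of the
system from which q has been removed ([unaffected], [absorbedP]), and those are
independent of the walk of q.  The walk of q may thus be replaced by a fresh copy
without changing the probability that it is at site k at the k-th time of the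
system without q ([swept], [resampling]).  Let now the fresh copy be a ghost
next to the original system, with q still in it.  If q ended none of the first K
stages, then the K times of the system without q are those of the whole system,
to which the ghosts are irrelevant; since the displacements of all ghosts have
the same law, at most one ghost on average stands on a given site at a given
time ([sum_resampled_hit_le1]), which gives at most K over the K stages.  The
leaders that did end a stage are at most K in number and contribute at most K
again ([pr_swept_le], [sum_swept_le]).  Markov's inequality with K a small
multiple of M concludes ([pr_tau_gt]).

All random inputs are gathered in one point of the product space of coordinates
indexed by the sources; independence, exchange of the walks of two particles
and replacement of a walk by a copy are then three uses of the uniqueness of a
law with given values on cylinders ([law_pushforward]).  The stage times are
measurable without discarding any null set, because each of them is an infimum
over countably many jump times ([measurable_dla_state]). *)

(** * Laws on a product space *)

Section coordinate_space.
Context {R : realType} {I : choiceType} (D0 : set I).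

Definition cylinder (s : {fset I}) (A : I -> set R) : set (I -> R) :=
  [set x | forall i, i \in s -> A i (x i)].

Definition cylinders : set (set (I -> R)) :=
  [set C | exists s A, [/\ [set` s] `<=` D0, (forall i, measurable (A i)) &
    C = cylinder s A]].

(** The sigma-algebra only sees the coordinates in [D0]: nothing is assumed on the
    joint law of the other ones. *)
Definition coords := g_sigma_algebraType cylinders.

Lemma cylindersI : setI_closed cylinders.
Proof.
move=> _ _ [s [A [sD mA ->]]] [s' [A' [s'D mA' ->]]].
exists (s `|` s')%fset.
exists (fun i => (if i \in s then A i else setT) `&`
                 (if i \in s' then A' i else setT)); split.
- by move=> i /=; rewrite in_fsetU => /orP[/sD|/s'D].
- by move=> i; apply: measurableI; case: ifP.
- apply/seteqP; split => [x [xA xA1] i|x xAA1].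
    by move=> _; split; case: ifP => //; [move/xA|move/xA1].
  split=> i si; have := xAA1 i; rewrite in_fsetU si ?orbT => /(_ isT) [].
    by [].
  by [].
Qed.

Lemma cylindersT : cylinders setT.
Proof.
exists fset0, (fun=> setT); split=> //.
by apply/seteqP; split.
Qed.

Lemma measurable_cylinder (s : {fset I}) (A : I -> set R) :
  [set` s] `<=` D0 -> (forall i, measurable (A i)) ->
  measurable (cylinder s A : set coords).
Proof. by move=> sD mA; apply: sub_sigma_algebra; exists s, A. Qed.

Lemma measurable_coord i : D0 i -> measurable_fun setT (fun x : coords => x i).
Proof.
move=> Di _ B mB; rewrite setTI.
rewrite (_ : _ @^-1` _ = cylinder [fset i]%fset (fun=> B)).
  by apply: measurable_cylinder => // j /=; rewrite in_fset1 => /eqP ->.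
apply/seteqP; split => [x xB j|x]; first by rewrite in_fset1 => /eqP ->.
by apply; rewrite in_fset1.
Qed.

(** Cylinders form a pi-system. *)
Lemma law_unique (m1 m2 : {measure set coords -> \bar R}) :
  (forall s A, [set` s] `<=` D0 -> (forall i, measurable (A i)) ->
    m1 (cylinder s A) = m2 (cylinder s A)) ->
  (m1 setT < +oo)%E -> forall A, measurable A -> m1 A = m2 A.
Proof.
move=> m12 m1T; apply: (@measure_unique _ R coords cylinders (fun=> setT)) => //.
- exact: cylindersI.
- by move=> _; exact: cylindersT.
- by rewrite bigcup_const.
- by move=> _ [s [A [sD mA ->]]]; exact: m12.
Qed.

Lemma law_pushforward d (U : measurableType d)
    (m1 : {measure set coords -> \bar R}) (m : {measure set U -> \bar R})
    (f : U -> coords) : measurable_fun setT f ->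
  (forall s A, [set` s] `<=` D0 -> (forall i, measurable (A i)) ->
    m1 (cylinder s A) = m (f @^-1` cylinder s A)) ->
  (m1 setT < +oo)%E ->
  forall A, measurable A -> m1 A = m (f @^-1` A).
Proof.
move=> mf; apply: (law_unique (m2 := pushforward m f)).
by move=> ?; exact: mf.
Qed.

Lemma measurable_coords d (U : measurableType d) (f : U -> coords) :
  (forall i, D0 i -> measurable_fun setT (fun u => f u i)) ->
  measurable_fun setT f.
Proof.
move=> mf; apply: (@measurability _ _ U coords setT f cylinders) => // _ [_ [s [A [sD mA ->]]] <-].
rewrite setTI.
rewrite (_ : _ @^-1` _ =
    \bigcap_(i in [set` s]) ((fun u => f u i) @^-1` A i)).
  apply: fin_bigcap_measurable => // i si.
  by rewrite -[X in measurable X]setTI; apply: mf => //; exact: sD.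
by apply/seteqP; split => u /= h i; exact: h.
Qed.

End coordinate_space.

Section resampling.
Context {R : realType} {I : choiceType} (D0 : set I).
Local Notation Om := (@coords R I D0).

Definition product_law (PP : probability Om R) :=
  forall s A, [set` s] `<=` D0 -> (forall i, measurable (A i)) ->
    PP (cylinder s A) = (\prod_(i <- s) PP [set x | A i (x i)])%E.

Definition mix (c : pred I) (xy : Om * Om) : Om :=
  fun i => if c i then xy.2 i else xy.1 i.

Lemma measurable_mix c : measurable_fun setT (mix c).
Proof.
apply: measurable_coords => i Di.
rewrite /mix; case: (c i).
- exact: (measurableT_comp (measurable_coord Di) measurable_snd).
- exact: (measurableT_comp (measurable_coord Di) measurable_fst).
Qed.

Variable PP : probability Om R.
Hypothesis PPP : product_law PP.

(** Each independent coordinate may be read off either of two independent copies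
    of the whole family. *)
Lemma resampling c (A : set Om) : measurable A ->
  PP A = (PP \x PP)%E [set xy | A (mix c xy)].
Proof.
move: A.
apply: (law_pushforward (m := (PP \x PP)%E) (measurable_mix c)).
- move=> s A sD mA /=.
  pose A1 i := if c i then setT else A i.
  pose A2 i := if c i then A i else setT.
  rewrite (_ : _ @^-1` _ = cylinder s A1 `*` cylinder s A2); last first.
    apply/seteqP; split => [[x y]|[x y] [hx hy] i si] /=.
      by move=> h; split => i si; rewrite /A1 /A2; have := h i si; rewrite /mix /=;
        case: (c i).
    have := hx i si; have := hy i si; rewrite /A1 /A2 /mix /=; by case: (c i).
  have mA1 i : measurable (A1 i) by rewrite /A1; case: (c i).
  have mA2 i : measurable (A2 i) by rewrite /A2; case: (c i).
  rewrite product_measure1E; [|exact: measurable_cylinder..].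
  rewrite PPP//.
  transitivity ((\prod_(i <- s) PP [set x | A1 i (x i)]) *
                (\prod_(i <- s) PP [set x | A2 i (x i)]))%E; last first.
    by congr (_ * _)%E; exact/esym/PPP.
  rewrite -big_split /=; apply: eq_bigr => i _.
  have PT : PP [set x | setT (x i)] = 1%E by rewrite -(probability_setT PP).
  by rewrite /A1 /A2; case: (c i); rewrite PT ?mul1e ?mule1.
- by apply: (@le_lt_trans _ _ 1%E); [exact: (probability_le1 PP)|exact: ltry].
Qed.

(** Two events that depend on complementary sets of coordinates: after resampling
    the coordinates of the second one, they live on different factors. *)
Lemma independent_events c (A B : set Om) : measurable A -> measurable B ->
  (forall x y, A (mix c (x, y)) <-> A x) ->
  (forall x y, B (mix c (x, y)) <-> B y) ->
  PP (A `&` B) = (PP A * PP B)%E.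
Proof.
move=> mA mB hA hB.
rewrite (resampling c); last exact: measurableI.
rewrite -product_measure1E//; congr (_ _).
by apply/seteqP; split => -[x y] /=; rewrite hA hB.
Qed.

(** The coordinates being independent, permuting those that have the same marginal
    law preserves the joint law. *)
Lemma relabelling (sg : I -> I) : injective sg -> (forall i, D0 i -> D0 (sg i)) ->
  (forall i (A : set R), D0 i -> measurable A ->
    PP [set x | A (x (sg i))] = PP [set x | A (x i)]) ->
  forall A : set Om, measurable A -> PP A = PP [set x : Om | A (fun i => x (sg i))].
Proof.
move=> sgI sgD marg.
have mf : measurable_fun setT (fun (x : Om) => (fun i => x (sg i)) : Om).
  by apply: measurable_coords => i Di; apply: measurable_coord; exact: sgD.
apply: (law_pushforward (m := PP) mf).
- move=> s A sD mA /=.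
  rewrite (_ : _ @^-1` _ = cylinder (sg @` s)%fset
     (fun j => if pselect (exists2 i, i \in s & j = sg i) is left e
               then A (s2val (cid2 e)) else setT)); last first.
    apply/seteqP; split => [x h j|x h i si] /=.
      case: pselect => // e _; case: (cid2 e) => i si /= ->; exact: h.
    have /(h (sg i)) : sg i \in (sg @` s)%fset by apply/imfsetP; exists i.
    case: pselect => [e|[]]; last by exists i.
    by case: (cid2 e) => i' /= si' /sgI ->.
  rewrite !PPP//.
  + rewrite big_imfset /=; last by move=> i j _ _ /sgI.
    rewrite 2!big_seq; apply: eq_bigr => i si.
    case: pselect => [e|[]]; last by exists i.
    case: (cid2 e) => i' /= si' /sgI <-; rewrite marg//; exact: sD.
  + by move=> j /= /imfsetP[i /= /sD Di ->]; exact: sgD.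
  + by move=> j; case: pselect.
- by apply: (@le_lt_trans _ _ 1%E); [exact: (probability_le1 PP)|exact: ltry].
Qed.

End resampling.

(** * Measurability of the positions of a walk *)

Section discrete_measurability.
Context d (U : measurableType d).

(** Measurability for values in a countable set, without having to equip the set
    (integers, pairs of them) with a sigma-algebra. *)
Definition discretely_measurable (V : Type) (f : U -> V) :=
  forall v, measurable [set u | f u = v].

Lemma measurable_cst_prop (Q : Prop) : measurable [set _ : U | Q].
Proof.
have [q|q] := pselect Q.
  by rewrite (_ : mkset _ = setT)//; apply/seteqP; split.
by rewrite (_ : mkset _ = set0)//; apply/seteqP; split.
Qed.

Lemma measurable_forall (Q : nat -> set U) : (forall n, measurable (Q n)) ->
  measurable [set u | forall n, Q n u].
Proof.
move=> mQ; rewrite (_ : mkset _ = \bigcap_n Q n); first exact: bigcapT_measurable.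
by apply/seteqP; split => u /= h n; [move=> _; exact: h|exact: h].
Qed.

Lemma measurable_exists (V : countType) (Q : V -> set U) :
  (forall n, measurable (Q n)) -> measurable [set u | exists n, Q n u].
Proof.
move=> mQ; rewrite (_ : mkset _ = \bigcup_(n in setT) Q n).
  by apply: countable_bigcupT_measurable => // *; exact: countableP.
by apply/seteqP; split => u /= [n]; [exists n|move=> _ ?; exists n].
Qed.

Lemma measurable_set_fun (V : countType) (f : U -> V) (A : set V) :
  discretely_measurable f -> measurable [set u | A (f u)].
Proof.
move=> mf; rewrite (_ : mkset _ = [set u | exists v, A v /\ f u = v]).
  apply: measurable_exists => v; rewrite (_ : (fun u => _) =
    [set _ | A v] `&` [set u | f u = v]) //.
  by apply: measurableI; [exact: measurable_cst_prop|exact: mf].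
by apply/seteqP; split => [u Au|u [v [Av /= ->]]] //=; exists (f u).
Qed.

Lemma discretely_measurable_comp (V V' : countType) (f : U -> V) (g : V -> V') :
  discretely_measurable f -> discretely_measurable (g \o f).
Proof. by move=> mf v; exact: (measurable_set_fun [set x | g x = v]). Qed.

Lemma discretely_measurable_pair (V V' : Type) (f : U -> V) (g : U -> V') :
  discretely_measurable f -> discretely_measurable g ->
  discretely_measurable (fun u => (f u, g u)).
Proof.
move=> mf mg [v v'].
rewrite (_ : mkset _ = [set u | f u = v] `&` [set u | g u = v']).
  exact: measurableI.
by apply/seteqP; split => u /= [-> ->].
Qed.

Lemma discretely_measurable_bool (A : set U) (b : U -> bool) :
  (forall u, b u <-> A u) -> measurable A -> discretely_measurable b.
Proof.
move=> bA mA [].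
  by rewrite (_ : mkset _ = A)//; apply/seteqP; split => u /bA.
rewrite (_ : mkset _ = ~` A); first exact: measurableC.
apply/seteqP; split => u /=; first by move=> bf /bA; rewrite bf.
by move=> nA; apply/negP => /bA.
Qed.

End discrete_measurability.

Section finitely_supported_sum.

Lemma fsbig_bounded (b : nat -> bool) (g : nat -> int) (M : nat) :
  (forall n, (M <= n)%N -> ~~ b n) ->
  \sum_(n \in [set n | b n]) g n = \sum_(n < M) (if b n then g n else 0).
Proof.
move=> bM.
transitivity (\sum_(n \in [set n | b n] `&` `I_M) g n).
  apply: eq_fsbigl; apply/seteqP; split=> n /=; last by case.
  by move=> bn; split=> //; rewrite ltnNge; apply: contraL bn => /bM.
rewrite fsbig_mkcondl -fsbig_ord; apply: eq_bigr => i _.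
by rewrite mem_setE.
Qed.

Lemma finite_set_nat_bounded (b : nat -> bool) :
  finite_set [set n | b n] <-> exists M, forall n, (M <= n)%N -> ~~ b n.
Proof.
split=> [/finite_seqP[s sE]|[M bM]].
  exists (\max_(i <- s) i).+1 => n; apply: contraTN => bn.
  have ns : n \in s by have : [set` s] n by rewrite -sE.
  by rewrite -leqNgt; exact: (leq_bigmax_seq (F := id)).
apply: (sub_finite_set _ (finite_II M)) => n /= bn.
by rewrite ltnNge; apply: contraL bn => /bM.
Qed.

(** The sum is a finite one on the event that the index set is bounded, and its
    default value 0 elsewhere; both events are countable combinations.  Summands
    must not vanish, lest an unbounded index set have a finite support. *)
Lemma measurable_fsbig d (U : measurableType d) (b : nat -> U -> bool)
    (g : nat -> U -> int) :
  (forall n, discretely_measurable (b n)) ->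
  (forall n, discretely_measurable (g n)) -> (forall n u, g n u != 0) ->
  discretely_measurable (fun u => \sum_(n \in [set n | b n u]) g n u).
Proof.
move=> mb mg g0 v.
have msum M : discretely_measurable
    (fun u => \sum_(n < M) (if b n u then g n u else 0)).
  elim: M => [|M IH].
    move=> w; rewrite (_ : mkset _ = [set _ | (0 : int) = w]).
      exact: measurable_cst_prop.
    by apply/seteqP; split => u /=; rewrite big_ord0.
  have h := discretely_measurable_comp
    (fun p : int * (bool * int) => p.1 + (if p.2.1 then p.2.2 else 0))
    (discretely_measurable_pair IH (discretely_measurable_pair (mb M) (mg M))).
  by move=> w; under eq_set do rewrite big_ord_recr /=; exact: (h w).
pose Fin M := [set u | forall n, (M <= n)%N -> ~~ b n u].
have mFin M : measurable (Fin M).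
  apply: (measurable_forall
    (Q := fun n => [set u | (M <= n)%N -> ~~ b n u])) => n.
  exact: (measurable_set_fun [set c : bool | (M <= n)%N -> ~~ c]).
pose E M := Fin M `&` [set u | \sum_(n < M) (if b n u then g n u else 0) = v].
rewrite (_ : mkset _ = [set u | exists M, E M u] `|`
    ((~` [set u | exists M, Fin M u]) `&` [set _ | 0 = v])).
  apply: measurableU; last apply: measurableI; last exact: measurable_cst_prop.
    by apply: measurable_exists => M; apply: measurableI => //; exact: msum.
  by apply: measurableC; exact: measurable_exists.
apply/seteqP; split => u /=.
  have [[M FM]|nF] := pselect (exists M, Fin M u).
    by rewrite (fsbig_bounded _ FM) => ?; left; exists M.
  rewrite fsbig_dflt; first by move=> ?; right.
  move=> h; apply: nF; apply/finite_set_nat_bounded.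
  apply: sub_finite_set h => n /= bn; split=> //.
  exact/eqP.
case=> [[M [FM <-]]|[nF <-]]; first by rewrite (fsbig_bounded _ FM).
rewrite fsbig_dflt// => h; apply: nF; apply/finite_set_nat_bounded.
by apply: sub_finite_set h => n /= bn; split=> //; exact/eqP.
Qed.

End finitely_supported_sum.

Section walk_measurability.
Context {R : realType} d (U : measurableType d).
Variables (h : nat -> U -> R) (r : nat -> U -> bool).
Hypothesis mh : forall n, measurable_fun setT (h n).
Hypothesis mr : forall n, discretely_measurable (r n).

Lemma measurable_jump_time n : measurable_fun setT (fun u => jump_time (h^~ u) n).
Proof. by apply: measurable_sum => m; exact: mh. Qed.

Lemma discretely_measurable_le (f g : U -> R) : measurable_fun setT f ->
  measurable_fun setT g -> discretely_measurable (fun u => f u <= g u).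
Proof.
move=> mf mg; apply: (@discretely_measurable_bool _ _ [set u | f u <= g u]) => //.
rewrite -[X in measurable X]setTI.
exact: (measurable_fun_le measurableT mf mg).
Qed.

Lemma discretely_measurable_lt (f g : U -> R) : measurable_fun setT f ->
  measurable_fun setT g -> discretely_measurable (fun u => f u < g u).
Proof.
move=> mf mg v.
rewrite (_ : mkset _ = [set u | (g u <= f u) = ~~ v]).
  exact: discretely_measurable_le.
by apply/seteqP; split => u /=; rewrite ltNge; [move=> <-; rewrite negbK|move=> ->; rewrite negbK].
Qed.

Lemma step_neq0 (ri : nat -> bool) n : step ri n != 0.
Proof. by rewrite /step; case: (ri n). Qed.

Lemma discretely_measurable_step n :
  discretely_measurable (fun u => step (r^~ u) n).
Proof.
exact: (discretely_measurable_comp (fun b : bool => if b then 1 else -1 : int) (mr n)).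
Qed.

Variables (x0 : int) (Y : U -> R).
Hypothesis mY : measurable_fun setT Y.

Lemma discretely_measurable_position :
  discretely_measurable (fun u => position (h^~ u) (r^~ u) x0 (Y u)).
Proof.
apply: (discretely_measurable_comp (fun z => x0 + z) (measurable_fsbig _ _ _)).
- by move=> n; apply: discretely_measurable_le => //; exact: measurable_jump_time.
- exact: discretely_measurable_step.
- by move=> n u; exact: step_neq0.
Qed.

Lemma discretely_measurable_position_left :
  discretely_measurable (fun u => position_left (h^~ u) (r^~ u) x0 (Y u)).
Proof.
apply: (discretely_measurable_comp (fun z => x0 + z) (measurable_fsbig _ _ _)).
- by move=> n; apply: discretely_measurable_lt => //; exact: measurable_jump_time.
- exact: discretely_measurable_step.
- by move=> n u; exact: step_neq0.
Qed.

End walk_measurability.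

(** * The path of a single walk *)

Section walk_path.
Context {R : realType}.
Variables (hold : nat -> R) (right : nat -> bool) (x : int).
Local Notation J := (jump_time hold).
Local Notation pos := (position hold right x).
Local Notation posl := (position_left hold right x).

Definition walk_after (n : nat) : int := x + \sum_(m < n) step right m.

(** Valid for arbitrary holding times, even when jumps accumulate: away from the
    jump times the index sets of the two sums coincide. *)
Lemma position_jump t : pos t <> posl t -> exists n, t = J n.
Proof.
move=> h; apply: contrapT => /forallNP nJ; apply: h; rewrite /position /position_left.
congr (_ + _); apply: eq_fsbigl; apply/seteqP; split=> n /=.
  by rewrite le_eqVlt => /orP[/eqP tJ|//]; case: (nJ n).
exact: ltW.
Qed.

Lemma position_count t c : (forall m, (J m <= t) = (m < c)%N) ->
  pos t = walk_after c.
Proof.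
move=> Jc; rewrite /position (@fsbig_bounded (fun m => J m <= t) _ c).
  by congr (_ + _); apply: eq_bigr => i _; rewrite Jc ltn_ord.
by move=> n cn; rewrite Jc -leqNgt.
Qed.

Lemma position_left_count t c : (forall m, (J m < t) = (m < c)%N) ->
  posl t = walk_after c.
Proof.
move=> Jc; rewrite /position_left (@fsbig_bounded (fun m => J m < t) _ c).
  by congr (_ + _); apply: eq_bigr => i _; rewrite Jc ltn_ord.
by move=> n cn; rewrite Jc -leqNgt.
Qed.

Lemma walk_afterS n : walk_after n.+1 = walk_after n + step right n.
Proof. by rewrite /walk_after big_ord_recr addrA. Qed.

Hypothesis hold_gt0 : forall n, 0 < hold n.

Lemma jump_timeS n : J n.+1 = J n + hold n.+1.
Proof. by rewrite /jump_time big_ord_recr. Qed.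

Lemma jump_time_gt0 n : 0 < J n.
Proof.
elim: n => [|n IH]; first by rewrite /jump_time big_ord1.
by rewrite jump_timeS addr_gt0.
Qed.

Lemma jump_time_le : {mono J : m n / (m <= n)%N >-> m <= n}.
Proof. by apply: Order.NatMonotonyTheory.incnP => n; rewrite jump_timeS ltrDl. Qed.

Lemma jump_time_lt : {mono J : m n / (m < n)%N >-> m < n}.
Proof. exact: leW_mono jump_time_le. Qed.

Lemma position_at_jump n : pos (J n) = walk_after n.+1.
Proof. by apply: position_count => m; rewrite jump_time_le. Qed.

Lemma position_left_at_jump n : posl (J n) = walk_after n.
Proof. by apply: position_left_count => m; rewrite jump_time_lt. Qed.

Lemma position0 : pos 0 = x.
Proof.
rewrite (@position_count 0 0) /walk_after ?big_ord0 ?addr0// => m.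
by rewrite ltn0; apply/negbTE; rewrite -ltNge jump_time_gt0.
Qed.

Hypothesis jump_unbounded : forall T, exists n, T < J n.

Lemma jump_count t : exists c, forall m, (J m <= t) = (m < c)%N.
Proof.
have [c Pc minc] := find_ex_minn (jump_unbounded t).
exists c => m; apply/idP/idP => [Jt|].
  by rewrite -jump_time_lt (le_lt_trans Jt).
by apply: contraTT; rewrite -ltNge -leqNgt; exact: minc.
Qed.

Lemma jump_count_left t : exists c, forall m, (J m < t) = (m < c)%N.
Proof.
have ex : exists n, t <= J n by have [n /ltW ?] := jump_unbounded t; exists n.
have [c Pc minc] := find_ex_minn ex.
exists c => m; apply/idP/idP => [Jt|].
  by rewrite -jump_time_lt (lt_le_trans Jt).
by apply: contraTT; rewrite -leNgt -leqNgt; exact: minc.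
Qed.

Lemma position_left_eq t : (forall n, t <> J n) -> posl t = pos t.
Proof.
by move=> tJ; apply: contrapT => h; have [|n /tJ] := @position_jump t; first exact/nesym.
Qed.

Lemma position_left_dist t :
  (pos t - posl t) \in [:: -1; 0; 1].
Proof.
have [[n ->]|/forallNP tJ] := pselect (exists n, t = J n); last first.
  by rewrite position_left_eq// subrr.
rewrite position_at_jump position_left_at_jump walk_afterS addrC addKr /step.
by case: (right n).
Qed.

(** Steps have size one, so that a walk above [k] must jump onto [k] before it can
    be anywhere below.  The bound [b] may be infinite. *)
Lemma walk_stays_above (k : int) (a : R) (b : \bar R) :
  k < pos a ->
  (forall u, a < u -> (u%:E < b)%E -> ~ (pos u = k /\ posl u <> k)) ->
  (forall u, a <= u -> (u%:E < b)%E -> k < pos u) /\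
  (forall u, a < u -> u%:E = b -> k < posl u).
Proof.
move=> ka nojump.
have [ca Jca] := jump_count a.
have above i : (forall n, (n < ca + i)%N -> ((J n)%:E < b)%E \/ (n < ca)%N) ->
    k < walk_after (ca + i).
  elim: i => [|i IH] h; first by rewrite addn0 -(position_count Jca).
  have {}IH : k < walk_after (ca + i).
    by apply: IH => n ni; apply: h; rewrite addnS ltnS ltnW.
  have aJ : a < J (ca + i) by rewrite ltNge Jca -leqNgt leq_addr.
  have Jb : ((J (ca + i))%:E < b)%E.
    by have [//||//] := h (ca + i)%N; rewrite ?addnS// ltnNge leq_addr.
  have := nojump _ aJ Jb.
  rewrite position_at_jump position_left_at_jump addnS => nj.
  have : k <= walk_after (ca + i).+1.
    rewrite walk_afterS /step; case: (right _).
      by rewrite ler_wpDr// ltW.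
    by rewrite lerBrDr lezD1.
  rewrite le_eqVlt => /orP[/eqP kE|//].
  by exfalso; apply: nj; split=> //; move: IH => /[swap] ->; rewrite ltxx.
split=> u au ub.
  have [cu Jcu] := jump_count u.
  have cacu : (ca <= cu)%N.
    rewrite leqNgt; apply/negP => h.
    have : J cu <= a by rewrite Jca.
    by move=> /le_trans /(_ au); rewrite Jcu ltnn.
  rewrite (position_count Jcu) -(subnKC cacu); apply: above => n.
  rewrite subnKC// -Jcu => Ju; left.
  by apply: le_lt_trans ub; rewrite lee_fin.
have [cu Jcu] := jump_count_left u.
have cacu : (ca <= cu)%N.
  rewrite leqNgt; apply/negP => h.
  have : J cu <= a by rewrite Jca.
  by move=> /le_lt_trans /(_ au); rewrite Jcu ltnn.
rewrite (position_left_count Jcu) -(subnKC cacu); apply: above => n.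
by rewrite subnKC// -Jcu => Ju; left; rewrite -ub lte_fin.
Qed.

End walk_path.

(** * Stages of the aggregate, with and without a given particle *)

Section aggregate_stages.
Context {R : realType}.
Implicit Types (init : set particle) (X Xl : particle -> R -> int).

Definition dla_white init X Xl k := (dla_state init X Xl k).2.

Definition hits init X Xl k : set R :=
  [set t | (dla_tau init X Xl k < t%:E)%E /\
           exists2 p, dla_white init X Xl k p & jumps_to X Xl p k t].

Lemma dla_tauS init X Xl k :
  dla_tau init X Xl k.+1 = ereal_inf [set t%:E | t in hits init X Xl k].
Proof. by rewrite /hits /dla_tau /dla_white /=; case: (dla_state init X Xl k). Qed.

Lemma dla_whiteS init X Xl k :
  dla_white init X Xl k.+1 = dla_white init X Xl k `\`
    [set p | exists2 t, dla_tau init X Xl k.+1 = t%:E & Xl p t = k.+1%:Z].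
Proof. by rewrite /dla_tau /dla_white /=; case: (dla_state init X Xl k). Qed.

Lemma dla_white_init init X Xl k : dla_white init X Xl k `<=` init.
Proof. by elim: k => [//|k IH]; rewrite dla_whiteS => p [/IH]. Qed.

Lemma dla_tau_nondecreasing init X Xl :
  {homo dla_tau init X Xl : k k' / (k <= k')%N >-> (k <= k')%E}.
Proof.
apply: (@homo_leq _ _ (fun x y => (x <= y)%E)) => // [y x z|k].
  exact: le_trans.
by rewrite dla_tauS; apply: le_ereal_inf_tmp => _ [t [/ltW ? _] <-].
Qed.

Lemma dla_tau_ge0 init X Xl k : (0 <= dla_tau init X Xl k)%E.
Proof. exact: (@dla_tau_nondecreasing init X Xl 0 k). Qed.

Lemma dla_state_ext init X Xl X' Xl' k :
  (forall p, init p -> X p = X' p) -> (forall p, init p -> Xl p = Xl' p) ->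
  dla_tau init X Xl k = dla_tau init X' Xl' k /\
  dla_white init X Xl k = dla_white init X' Xl' k.
Proof.
move=> eX eXl; elim: k => [//|k [IHt IHw]].
have eh : hits init X Xl k = hits init X' Xl' k.
  rewrite /hits IHt IHw; apply/seteqP; split => t /= [tau_t [p wp]];
    have ip := dla_white_init wp; rewrite /jumps_to;
    [rewrite eX// eXl//|rewrite -eX// -eXl//] => ?; by split=> //; exists p.
have et : dla_tau init X Xl k.+1 = dla_tau init X' Xl' k.+1.
  by rewrite !dla_tauS eh.
split=> //; rewrite !dla_whiteS et IHw; apply/seteqP.
by split => p /= [wp np]; split=> // -[t Et Xp]; apply: np; exists t => //;
  rewrite ?eXl// -?eXl//; exact: dla_white_init wp.
Qed.

End aggregate_stages.

Section removal.
Context {R : realType}.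
Variables (init : set particle) (X Xl : particle -> R -> int) (q : particle).
Local Notation tau := (dla_tau init X Xl).
Local Notation white := (dla_white init X Xl).
Local Notation tau' := (dla_tau (init `\ q) X Xl).
Local Notation white' := (dla_white (init `\ q) X Xl).

(** The strict inequality makes the jump of [q] one of the [hits] of stage [k]: a jump
    at the very time at which the stage begins is not noticed by the process. *)
Definition jumper (k : nat) : Prop :=
  white k q /\ exists2 s, tau k.+1 = s%:E & (tau k < s%:E)%E /\ jumps_to X Xl q k s.

Definition unaffected (k : nat) : Prop := tau' k = tau k /\ white' k = white k `\ q.

Lemma unaffected0 : unaffected 0.
Proof. by split. Qed.

(* Among its jump times, a walk has a first one with a given property, while the
   infimum over all particles need not be attained. *)
Hypothesis jumps_listed : exists2 J : nat -> R, {homo J : m n / (m <= n)%N >-> m <= n} &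
  forall k t, jumps_to X Xl q k t -> exists n, t = J n.

(** Restoring [q] can only lower the infimum that defines the next stage time, and
    only through a jump of [q] itself.  The earliest such jump would then be the
    infimum, and [q] would be a jumper. *)
Lemma tau_unaffected k : unaffected k -> ~ jumper k -> tau' k.+1 = tau k.+1.
Proof.
move=> [eqt eqw] nj; apply/eqP; rewrite eq_le; apply/andP; split; last first.
  rewrite !dla_tauS; apply: ereal_inf_le_tmp => e [t [tt [p]]].
  rewrite eqw => -[wp _] jp <-; exists t => //; split; first by rewrite -eqt.
  by exists p.
rewrite leNgt; apply/negP => lt_tau; apply: nj.
move: lt_tau; rewrite [X in (X < _)%E]dla_tauS => /ereal_inf_lt[e [t0 ht0 e0]]; rewrite -{e}e0 => t0lt.
(* before the stage time of the system without [q], only [q] can hit *)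
have early t : hits init X Xl k t -> (t%:E < tau' k.+1)%E ->
    white k q /\ jumps_to X Xl q k t.
  move=> [tt [p wp jp]] tlt; have [pq|/eqP pq] := eqVneq p q; first by rewrite -pq.
  exfalso; move: tlt; rewrite ltNge => /negP; apply.
  rewrite dla_tauS; apply: ereal_inf_lbound; exists t => //; split.
    by rewrite eqt.
  by exists p => //; rewrite eqw.
have [wq jq0] := early _ ht0 t0lt.
have [J Jmono Jall] := jumps_listed.
have exn : exists n, `[< hits init X Xl k (J n) /\ ((J n)%:E < tau' k.+1)%E >].
  have [n t0n] := Jall _ _ jq0; exists n; apply/asboolP; rewrite -t0n; split => //.
have [n /asboolP[hn nlt] minn] := find_ex_minn exn.
have tauE : tau k.+1 = (J n)%:E.
  apply/eqP; rewrite eq_le; apply/andP; split.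
    by rewrite dla_tauS; apply: ereal_inf_lbound; exists (J n).
  rewrite dla_tauS; apply: le_ereal_inf_tmp => _ [t ht <-].
  rewrite lee_fin leNgt; apply/negP => tn.
  have tlt : (t%:E < tau' k.+1)%E by apply: lt_trans nlt; rewrite lte_fin.
  have [_ jt] := early _ ht tlt.
  have [m tm] := Jall _ _ jt.
  have nm : (n <= m)%N by apply: minn; apply/asboolP; rewrite -tm.
  by have := Jmono _ _ nm; rewrite -tm leNgt tn.
split=> //; exists (J n) => //; split; first by case: hn.
by have [] := early _ hn nlt.
Qed.

Lemma unaffectedS k : unaffected k -> ~ jumper k -> unaffected k.+1.
Proof.
move=> un nj; have et := tau_unaffected un nj; case: un => _ ew; split=> //.
rewrite !dla_whiteS et ew; apply/seteqP.
by split=> p /= [[? ?] ?].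
Qed.

Lemma never_jumper_unaffected K : (forall k, (k < K)%N -> ~ jumper k) ->
  forall k, (k <= K)%N -> unaffected k.
Proof.
move=> nj; elim=> [_|k IH kK]; first exact: unaffected0.
by apply: unaffectedS; [exact/IH/ltnW|exact: nj].
Qed.

Lemma tau_removal_ge k : unaffected k -> (tau k.+1 <= tau' k.+1)%E.
Proof.
move=> [eqt eqw]; rewrite !dla_tauS; apply: ereal_inf_le_tmp => e [t [tt [p]]].
rewrite eqw => -[wp _] jp <-; exists t => //; split; first by rewrite -eqt.
by exists p.
Qed.

End removal.

Section walkers.
Context {R : realType}.
Variables (init : set particle) (hold : particle -> nat -> R)
  (right : particle -> nat -> bool).
Local Notation X := (fun p => position (hold p) (right p) p.1%:Z).
Local Notation Xl := (fun p => position_left (hold p) (right p) p.1%:Z).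
Local Notation tau := (dla_tau init X Xl).
Local Notation white := (dla_white init X Xl).
Local Notation tau_without q := (dla_tau (init `\ q) X Xl).

(** The last condition excludes ties between the jumps of [q] and the stage times
    that the other particles determine. *)
Definition generic (q : particle) : Prop :=
  [/\ (0 < q.1)%N, forall n, 0 < hold q n,
      forall T, exists n, T < jump_time (hold q) n &
      forall k n, tau_without q k <> (jump_time (hold q) n)%:E].

Lemma walker_jumps_listed q : (forall n, 0 < hold q n) ->
  exists2 J : nat -> R, {homo J : m n / (m <= n)%N >-> m <= n} &
    forall k t, jumps_to X Xl q k t -> exists n, t = J n.
Proof.
move=> hq; exists (jump_time (hold q)).
  by move=> m n; rewrite jump_time_le.
by move=> k t [Xk Xlk]; apply: (@position_jump _ _ (right q) q.1%:Z); rewrite Xk; exact: nesym.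
Qed.

Lemma no_jump_between q k s u : white k q -> tau k = s%:E -> s < u ->
  (u%:E < tau k.+1)%E -> ~ jumps_to X Xl q k u.
Proof.
rewrite -lte_fin => wq <- ku uk jq; move: uk; rewrite ltNge => /negP; apply.
by rewrite dla_tauS; apply: ereal_inf_lbound; exists u => //; split=> //; exists q.
Qed.

Lemma tau_fin k s : tau k.+1 = s%:E -> exists s', tau k = s'%:E /\ s' <= s.
Proof.
move=> ts; have := dla_tau_nondecreasing init X Xl (leqnSn k).
have := dla_tau_ge0 init X Xl k; rewrite ts.
by case: (tau k) => // s' _; rewrite lee_fin => ?; exists s'.
Qed.

(** Both statements are proved together.  That [q] is above the aggregate shows that
    a jump of [q] onto it comes from the site that is being absorbed, so that a
    particle which is still white has not been a jumper and is unaffected; and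
    being unaffected rules out that [q] jumps onto the new site at the very moment
    of its absorption, a jump that would escape notice. *)
Lemma white_invariant q : generic q -> forall k, white k q ->
  unaffected init X Xl q k /\ forall s, tau k = s%:E -> k%:Z < X q s.
Proof.
move=> [q1 hq Jq gq]; elim=> [_|k IH wq].
  split; first exact: unaffected0.
  by move=> s [<-]; rewrite position0.
have [wk nabs] : white k q /\ ~ exists2 t, tau k.+1 = t%:E & Xl q t = k.+1%:Z.
  by move: wq; rewrite dla_whiteS.
have [un above] := IH wk.
(* just before the stage ends, a particle that survives it is at distance at
   least two from the aggregate *)
have left_above s s' : tau k = s%:E -> tau k.+1 = s'%:E -> s < s' ->
    k.+1%:Z < Xl q s'.
  move=> ks ks' ss'.
  have [_ /(_ s' ss')] := @walk_stays_above R _ (right q) q.1%:Z hq Jq k%:Z s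
    (tau k.+1) (above _ ks)
    (fun u => no_jump_between wk ks).
  rewrite ks' => /(_ erefl); rewrite -lezD1 le_eqVlt => /orP[/eqP e|].
    by exfalso; apply: nabs; exists s' => //; rewrite -e intS addrC.
  by rewrite intS addrC.
have nj : ~ jumper init X Xl q k.
  move=> [_ [s' ks' [kls' [Xk _]]]].
  have [s [ks ss']] := tau_fin ks'.
  have := left_above s s' ks ks'; move: kls'; rewrite ks lte_fin => lss' /(_ lss').
  have := @position_left_dist R _ (right q) q.1%:Z hq s'.
  rewrite Xk; set y := position_left _ _ _ _.
  by rewrite !inE => /or3P[]/eqP; lia.
have un' := unaffectedS (walker_jumps_listed hq) un nj.
split=> // s' ks'.
have [s [ks ss']] := tau_fin ks'.
have eX : Xl q s' = X q s'.
  apply: position_left_eq => n e; apply: (gq k.+1 n).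
  by rewrite -e -ks'; case: un'.
move: ss'; rewrite le_eqVlt => /orP[/eqP es|ss'].
  have := above _ ks; rewrite es -lezD1 le_eqVlt => /orP[/eqP e|].
    exfalso; apply: nabs; exists s' => //; rewrite eX.
    by rewrite -e intS addrC.
  by rewrite intS addrC.
by rewrite -eX; exact: (left_above s).
Qed.

Lemma white_above q k u : generic q -> white k q ->
  (tau k <= u%:E)%E -> (u%:E < tau k.+1)%E -> k%:Z < X q u.
Proof.
move=> gq wk ku uk; have [un above] := white_invariant gq wk.
have [q1 hq Jq _] := gq.
have [s ks] : exists s, tau k = s%:E.
  have := dla_tau_ge0 init X Xl k; move: ku; case: (tau k) => // s _ _.
  by exists s.
have [+ _] := @walk_stays_above R _ (right q) q.1%:Z hq Jq k%:Z s
    (tau k.+1) (above _ ks)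
    (fun u => no_jump_between wk ks).
by apply => //; rewrite -lee_fin -ks.
Qed.

Lemma dla_white_nonincreasing k k' : (k <= k')%N -> white k' `<=` white k.
Proof.
move=> /subnKC <-; elim: (k' - k)%N => [|i IH]; first by rewrite addn0.
by rewrite addnS dla_whiteS => p [/IH].
Qed.

(** In terms of the process: the white particles are above the aggregate, which
    contains the origin. *)
Lemma nonpositive_absorbed q K u : generic q -> 0 <= u -> (u%:E < tau K)%E ->
  X q u <= 0 -> ~ white K q.
Proof.
move=> gq u0 uK Xu wK.
have [i [iK [ui uSi]]] : exists i, (i < K)%N /\ (tau i <= u%:E)%E /\ (u%:E < tau i.+1)%E.
  elim: K uK {wK} => [|K IH] uK.
    by move: uK; rewrite /dla_tau /= lte_fin ltNge u0.
  have [uK'|Ku] := ltP u%:E (tau K); last by exists K.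
  by have [i [iK h]] := IH uK'; exists i; split=> //; rewrite ltnS ltnW.
have := white_above gq (dla_white_nonincreasing (ltnW iK) wK) ui uSi.
by lia.
Qed.

Lemma absorbedP q K : generic q -> init q -> ~ white K q ->
  (exists2 k, (k < K)%N & jumper init X Xl q k) \/
  (exists2 k, (k < K)%N & exists2 s, tau_without q k.+1 = s%:E & Xl q s = k.+1%:Z).
Proof.
move=> gq iq; elim: K => [//|K IH] nw.
have [wK|/IH] := pselect (white K q); last first.
  by case=> -[k kK h]; [left|right]; exists k => //; rewrite ltnS ltnW.
have [un _] := white_invariant gq wK.
have [q1 hq Jq _] := gq.
have [s ts Xs] : exists2 t, tau K.+1 = t%:E & Xl q t = K.+1%:Z.
  by apply: contrapT => h; apply: nw; rewrite dla_whiteS.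
have [j|nj] := pselect (jumper init X Xl q K); first by left; exists K.
right; exists K => //; exists s => //.
by rewrite -ts; apply: tau_unaffected => //; exact: walker_jumps_listed.
Qed.

(** If [q] ends the stage, then the system without [q'] has the same stage time, with
    which the jump of [q'] cannot coincide. *)
Lemma jumper_unique q q' k : generic q' -> jumper init X Xl q k ->
  jumper init X Xl q' k -> q = q'.
Proof.
move=> gq' [wq [s ts [kls jq]]] [wq' [s' ts' [_ jq']]].
apply: contrapT => qq'.
have [un _] := white_invariant gq' wq'.
have [_ hq' _ gen] := gq'.
have [n sn] : exists n, s' = jump_time (hold q') n.
  case: jq' => Xk Xlk; apply: (@position_jump _ _ (right q') q'.1%:Z).
  by rewrite Xk; exact: nesym.
apply: (gen k.+1 n); rewrite -sn -ts'.
apply/eqP; rewrite eq_le (tau_removal_ge un) andbT ts dla_tauS.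
apply: ereal_inf_lbound; exists s => //; case: un => et ew; split.
  by rewrite et.
by exists q => //; rewrite ew.
Qed.

End walkers.

(** * Measurability of the stages *)

Section aggregate_measurability.
Context {R : realType} d (U : measurableType d).

Lemma measurable_ereal_lt (f : U -> \bar R) :
  (forall r : R, measurable [set u | (f u < r%:E)%E]) -> measurable_fun setT f.
Proof.
move=> mf; apply: (measurability _ (ErealGenInftyO.measurableE R)) => // _ [_ [r ->] <-].
rewrite setTI (_ : _ @^-1` _ = [set u | (f u < r%:E)%E]); first exact: mf.
by apply/seteqP; split => u /=; rewrite in_itv.
Qed.

Lemma measurable_position_left_at (h : nat -> U -> R) (r : nat -> U -> bool)
    (x z : int) (f : U -> \bar R) :
  (forall n, measurable_fun setT (h n)) -> (forall n, discretely_measurable (r n)) ->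
  measurable_fun setT f ->
  measurable [set u | exists2 s, f u = s%:E &
    position_left (h^~ u) (r^~ u) x s = z].
Proof.
move=> mh mr mf.
have mff : measurable_fun setT (fine \o f) by exact: measurableT_comp.
rewrite (_ : mkset _ = (setT `&` [set u | f u = ((fine \o f) u)%:E]) `&`
    [set u | position_left (h^~ u) (r^~ u) x ((fine \o f) u) = z]).
  apply: measurableI; last exact: discretely_measurable_position_left.
  by apply: measurable_eqe => //; exact/measurable_EFinP.
apply/seteqP; split => u /= [].
  by move=> s -> /= <-.
by move=> [_ ->] /= <-; exists (fine (f u)).
Qed.

Lemma measurable_position_at (h : nat -> U -> R) (r : nat -> U -> bool)
    (x z : int) (f : U -> \bar R) :
  (forall n, measurable_fun setT (h n)) -> (forall n, discretely_measurable (r n)) ->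
  measurable_fun setT f ->
  measurable [set u | exists2 s, f u = s%:E &
    position (h^~ u) (r^~ u) x s = z].
Proof.
move=> mh mr mf.
have mff : measurable_fun setT (fine \o f) by exact: measurableT_comp.
rewrite (_ : mkset _ = (setT `&` [set u | f u = ((fine \o f) u)%:E]) `&`
    [set u | position (h^~ u) (r^~ u) x ((fine \o f) u) = z]).
  apply: measurableI; last exact: discretely_measurable_position.
  by apply: measurable_eqe => //; exact/measurable_EFinP.
apply/seteqP; split => u /= [].
  by move=> s -> /= <-.
by move=> [_ ->] /= <-; exists (fine (f u)).
Qed.

Variables (init : U -> set particle) (H : particle -> nat -> U -> R)
  (G : particle -> nat -> U -> bool).
Hypothesis init_gt0 : forall u p, init u p -> (0 < p.1)%N.
Hypothesis minit : forall p, measurable [set u | init u p].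
Hypothesis mH : forall p n, (0 < p.1)%N -> measurable_fun setT (H p n).
Hypothesis mG : forall p n, (0 < p.1)%N -> discretely_measurable (G p n).

Local Notation X u := (fun p => position (H p ^~ u) (G p ^~ u) p.1%:Z).
Local Notation Xl u := (fun p => position_left (H p ^~ u) (G p ^~ u) p.1%:Z).

(** A stage ends before time [r] exactly when some jump time before [r] of some
    white particle is a hit, which is a countable union of events. *)
Lemma measurable_dla_state k :
  measurable_fun setT (fun u => dla_tau (init u) (X u) (Xl u) k) /\
  forall p, measurable [set u | dla_white (init u) (X u) (Xl u) k p].
Proof.
elim: k => [|k [mt mw]].
  by split=> [|p]; [exact: measurable_cst|exact: minit].
have mtS : measurable_fun setT (fun u => dla_tau (init u) (X u) (Xl u) k.+1).
  apply: measurable_ereal_lt => r.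
  rewrite (_ : mkset _ = [set u | exists pn : nat * nat * nat,
      (0 < pn.1.1)%N /\
      ([set u | dla_white (init u) (X u) (Xl u) k pn.1] `&`
      ((setT `&` [set u | (dla_tau (init u) (X u) (Xl u) k <
        (jump_time (H pn.1 ^~ u) pn.2)%:E)%E]) `&`
      ((setT `&` [set u | ((jump_time (H pn.1 ^~ u) pn.2)%:E < r%:E)%E]) `&`
      [set u | jumps_to (X u) (Xl u) pn.1 k (jump_time (H pn.1 ^~ u) pn.2)]))) u]); last first.
    apply/seteqP; split => u /=.
      rewrite dla_tauS => /ereal_inf_lt[e [t [tt [p wp jp]] te]].
      rewrite -{e}te => tr.
      have [n tn] : exists n, t = jump_time (H p ^~ u) n.
        case: jp => Xk Xlk; apply: (@position_jump _ _ (G p ^~ u) p.1%:Z).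
        by rewrite Xk; exact: nesym.
      exists (p, n) => /=; rewrite -tn; split=> //.
      exact/init_gt0/(dla_white_init wp).
    move=> [[p n]] /= [p1 [wp [[_ ltJ] [[_ Jr] jp]]]].
    apply: le_lt_trans Jr; rewrite dla_tauS; apply: ereal_inf_lbound.
    by exists (jump_time (H p ^~ u) n) => //; split=> //; exists p.
  apply: measurable_exists => -[p n].
  have [p0|p0] := posnP p.1.
    rewrite (_ : (fun u => _) = set0)//; apply/seteqP; by split=> u //= [].
  have mJ : measurable_fun setT (fun u => jump_time (H p ^~ u) n).
    by apply: measurable_jump_time => m; exact: mH.
  rewrite (_ : (fun u => _) = [set u | dla_white (init u) (X u) (Xl u) k p] `&`
      ((setT `&` [set u | (dla_tau (init u) (X u) (Xl u) k <
        (jump_time (H p ^~ u) n)%:E)%E]) `&`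
      ((setT `&` [set u | ((jump_time (H p ^~ u) n)%:E < r%:E)%E]) `&`
      ([set u | X u p (jump_time (H p ^~ u) n) = k] `&`
      ~` [set u | Xl u p (jump_time (H p ^~ u) n) = k])))); last first.
    by apply/seteqP; split=> u [].
  apply: measurableI; first exact: mw.
  apply: measurableI; first by apply: measurable_lte => //; exact/measurable_EFinP.
  apply: measurableI; first by apply: measurable_lte => //; exact/measurable_EFinP.
  apply: measurableI; last apply: measurableC.
    by apply: discretely_measurable_position => // m; [exact: mH|exact: mG].
  by apply: discretely_measurable_position_left => // m; [exact: mH|exact: mG].
split=> // p.
have [p0|p0] := posnP p.1.
  rewrite (_ : mkset _ = set0)//; apply/seteqP; split=> u //=.
  by move/dla_white_init/init_gt0; rewrite p0.
rewrite (_ : mkset _ = [set u | dla_white (init u) (X u) (Xl u) k p] `\`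
   [set u | exists2 s, dla_tau (init u) (X u) (Xl u) k.+1 = s%:E &
    position_left (H p ^~ u) (G p ^~ u) p.1%:Z s = k.+1%:Z]); last first.
  by apply/seteqP; split=> u; rewrite /= dla_whiteS.
apply: measurableD; first exact: mw.
by apply: measurable_position_left_at => // m; [exact: mH|exact: mG].
Qed.

End aggregate_measurability.

(** * First and second moments of counts of events *)

Section weighted_indicators.
Context d (T : measurableType d) {R : realType} (m : {measure set T -> \bar R}).
Hypothesis m_le1 : (m setT <= 1)%E.
Implicit Types (s : seq (R * set T)) (A B : set T).

(** Real-valued, to make finite sums amenable to linear arithmetic. *)
Definition pr A : R := fine (m A).

(** Linear combinations of indicators are encoded as lists of weights and events,
    so that one comparison lemma covers first moments, second moments, constants
    and unions. *)
Definition weighted s : Prop :=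
  forall c, List.In c s -> 0 <= c.1 /\ measurable c.2.

Lemma pr_ge0 A : 0 <= pr A.
Proof. exact: fine_ge0. Qed.

Lemma prE A : measurable A -> m A = (pr A)%:E.
Proof.
move=> mA; rewrite /pr fineK// ge0_fin_numE//.
apply: le_lt_trans (ltry 1); apply: le_trans m_le1.
by apply: le_measure; rewrite ?inE.
Qed.

Lemma pr_le1 A : measurable A -> pr A <= 1.
Proof.
move=> mA; rewrite -lee_fin -prE//; apply: le_trans m_le1.
by apply: le_measure; rewrite ?inE.
Qed.

Lemma pr_le A B : measurable A -> measurable B -> A `<=` B -> pr A <= pr B.
Proof.
by move=> mA mB AB; rewrite -lee_fin -!prE//; apply: le_measure; rewrite ?inE.
Qed.

Lemma integral_weighted s : weighted s ->
  (\int[m]_x (\sum_(c <- s) c.1 * \1_(c.2) x)%:E = (\sum_(c <- s) c.1 * pr c.2)%:E)%E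
  /\ measurable_fun setT (fun x => \sum_(c <- s) c.1 * \1_(c.2) x)
  /\ forall x, 0 <= \sum_(c <- s) c.1 * \1_(c.2) x.
Proof.
elim: s => [|c s IH] ws.
  split; first by under eq_integral do rewrite big_nil; rewrite integral0 big_nil.
  split; first by under eq_fun do rewrite big_nil; exact: measurable_cst.
  by move=> x; rewrite big_nil.
have [e [mf f0]] : _ /\ _ := IH (fun c' h => ws c' (or_intror h)).
have [c0 mc] := ws c (or_introl erefl).
have mc' : measurable_fun setT (fun x => c.1 * \1_(c.2) x).
  by apply: measurable_funM; [exact: measurable_cst|exact: measurable_indic].
split; last split.
- under eq_integral do rewrite big_cons EFinD.
  rewrite ge0_integralD//=.
  + rewrite e big_cons EFinD; congr (_ + _)%E.
    under eq_integral do rewrite EFinM.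
    rewrite ge0_integralZl_EFin//; last by apply/measurable_EFinP; exact: measurable_indic.
    by rewrite integral_indic// setIT EFinM prE.
  + by move=> x _; rewrite lee_fin mulr_ge0.
  + exact/measurable_EFinP.
  + by move=> x _; rewrite lee_fin.
  + exact/measurable_EFinP.
- by under eq_fun do rewrite big_cons; exact: measurable_funD.
- by move=> x; rewrite big_cons addr_ge0// mulr_ge0.
Qed.

(** The inequality may fail on a negligible set: the left-hand side being bounded,
    this adds a multiple of the indicator of a null set on the right. *)
Lemma weighted_le s s' (Bad : set T) : weighted s -> weighted s' ->
  m.-negligible Bad ->
  (forall x, ~ Bad x -> \sum_(c <- s) c.1 * \1_(c.2) x <= \sum_(c <- s') c.1 * \1_(c.2) x) ->
  \sum_(c <- s) c.1 * pr c.2 <= \sum_(c <- s') c.1 * pr c.2.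
Proof.
move=> ws ws' [B [mB B0 BadB]] le_ss'.
pose K := \sum_(c <- s) c.1.
have K0 : 0 <= K.
  rewrite /K; elim: s ws {le_ss' K} => [|c s IH] ws; first by rewrite big_nil.
  rewrite big_cons addr_ge0//; first by have [] := ws c (or_introl erefl).
  by apply: IH => c' h; apply: ws; right.
have sK x : \sum_(c <- s) c.1 * \1_(c.2) x <= K.
  rewrite /K; elim: s ws {le_ss' K K0} => [|c s IH] ws; first by rewrite !big_nil.
  rewrite !big_cons lerD//; last by apply: IH => c' h; apply: ws; right.
  have [c0 _] := ws c (or_introl erefl).
  by rewrite ler_piMr// indicE; case: (_ \in _).
have ws'' : weighted ((K, B) :: s') by move=> c /= [<-//|]; exact: ws'.
have [e [mf f0]] := integral_weighted ws.
have [e' [mf' f0']] := integral_weighted ws''.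
suff : (\int[m]_x (\sum_(c <- s) c.1 * \1_(c.2) x)%:E <=
   \int[m]_x (\sum_(c <- (K, B) :: s') c.1 * \1_(c.2) x)%:E)%E.
  by rewrite e e' lee_fin big_cons /= /pr B0 mulr0 add0r.
apply: ge0_le_integral => //; [by move=> x _; rewrite lee_fin|
  exact/measurable_EFinP|exact/measurable_EFinP|].
move=> x _; rewrite lee_fin big_cons /= indicE.
have [Bx|nBx] := pselect (B x).
  rewrite mem_set// mulr1 (le_trans (sK x))// lerDl.
  by have [_ [_ h]] := integral_weighted ws'; exact: h.
rewrite memNset// mulr0 add0r; apply: le_ss' => /BadB; exact: nBx.
Qed.

Lemma weighted1 (I : finType) (A : I -> set T) : (forall j, measurable (A j)) ->
  weighted [seq (1, A j) | j <- enum I].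
Proof.
by move=> mA c; elim: (enum I) => [|j r IH] //= [<-|/IH] //=.
Qed.

Lemma sum_weighted1 (I : finType) (A : I -> set T) (f : set T -> R) :
  \sum_(c <- [seq (1, A j) | j <- enum I]) c.1 * f c.2 = \sum_j f (A j).
Proof. by rewrite big_map big_enum /=; apply: eq_bigr => j _; rewrite mul1r. Qed.

Lemma weighted_cons a A s : 0 <= a -> measurable A -> weighted s ->
  weighted ((a, A) :: s).
Proof. by move=> a0 mA ws c /= [<-//|]; exact: ws. Qed.

Lemma weighted_nil : weighted [::]. Proof. by []. Qed.

Lemma sum_pr_le (I : finType) (A : I -> set T) (c : R) (Bad : set T) :
  (forall j, measurable (A j)) -> m.-negligible Bad -> 0 <= c ->
  (forall x, ~ Bad x -> \sum_j \1_(A j) x <= c) -> \sum_j pr (A j) <= c.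
Proof.
move=> mA nB c0 Ac.
have wT : weighted [:: (c, setT)] by apply: weighted_cons => //; exact: weighted_nil.
have := weighted_le (weighted1 mA) wT nB.
rewrite !big_seq1 sum_weighted1 => h.
apply: (@le_trans _ _ (c * pr setT)).
  apply: h => x /Ac; rewrite (sum_weighted1 A (fun B => \1_B x)) big_seq1.
  by rewrite indicT mulr1.
by rewrite ler_piMr// pr_le1.
Qed.

Lemma union_bound (I : finType) (A : I -> set T) B Bad : (forall j, measurable (A j)) ->
  measurable B -> m.-negligible Bad ->
  (forall x, B x -> Bad x \/ exists j, A j x) ->
  pr B <= \sum_j pr (A j).
Proof.
move=> mA mB nB BA.
have wB : weighted [:: (1, B)] by apply: weighted_cons => //; exact: weighted_nil.
have := weighted_le wB (weighted1 mA) nB.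
rewrite !big_seq1 sum_weighted1 mul1r; apply => x nBx.
rewrite (sum_weighted1 A (fun B => \1_B x)) big_seq1 mul1r.
have [Bx|nB'] := pselect (B x); last by rewrite indicE memNset// sumr_ge0.
have [//|[j Aj]] := BA _ Bx.
rewrite (bigD1 j)//= [\1_(A j) x]indicE mem_set// indicE mem_set//.
by rewrite lerDl sumr_ge0.
Qed.

Lemma markov_count (I : finType) (A : I -> set T) (h : R) : (forall j, measurable (A j)) ->
  measurable [set x | h <= \sum_j \1_(A j) x] ->
  0 <= h -> h * pr [set x | h <= \sum_j \1_(A j) x] <= \sum_j pr (A j).
Proof.
move=> mA mB h0.
have wB : weighted [:: (h, [set x | h <= \sum_j \1_(A j) x])].
  by apply: weighted_cons => //; exact: weighted_nil.
have := weighted_le wB (weighted1 mA) (negligible_set0 m).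
rewrite !big_seq1 sum_weighted1; apply => x _.
rewrite (sum_weighted1 A (fun B => \1_B x)) big_seq1 /= indicE.
case: (boolP (_ \in _)); first by rewrite inE /= mulr1.
by rewrite mulr0 sumr_ge0.
Qed.

Lemma measurable_count_le (I : finType) (A : I -> set T) (h : R) :
  (forall j, measurable (A j)) -> measurable [set x | \sum_j \1_(A j) x <= h].
Proof.
move=> mA; rewrite -[X in measurable X]setTI.
apply: measurable_fun_le => //; apply: measurable_sum => j; exact: measurable_indic.
Qed.

Lemma measurable_count_ge (I : finType) (A : I -> set T) (h : R) :
  (forall j, measurable (A j)) -> measurable [set x | h <= \sum_j \1_(A j) x].
Proof.
move=> mA; rewrite -[X in measurable X]setTI.
apply: measurable_fun_le => //; apply: measurable_sum => j; exact: measurable_indic.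
Qed.

(** With [N] the count, [mu] its mean and [B] the event, [N <= mu / 2] on [B] gives
    [mu ^+ 2 / 4 * \1_B + 2 * mu * N <= mu ^+ 2 + N ^+ 2] everywhere, and pairwise
    independence bounds the mean of [N ^+ 2] by [mu ^+ 2 + mu]. *)
Lemma chebyshev_count n (A : 'I_n -> set T) (c : R) :
  (forall j, measurable (A j)) -> (0 < n)%N -> 0 < c -> pr setT = 1 ->
  (forall i j, i != j -> pr (A i `&` A j) = pr (A i) * pr (A j)) ->
  (forall j, c <= pr (A j)) ->
  pr [set x | \sum_j \1_(A j) x <= c * n%:R / 2] <= 4 / (c * n%:R).
Proof.
move=> mA n0 c0 prT indep cA; set B := [set x | _].
have mB : measurable B by exact: measurable_count_le.
pose mu := \sum_j pr (A j).
have cn0 : 0 < c * n%:R by rewrite mulr_gt0// ltr0n.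
have cmu : c * n%:R <= mu.
  rewrite /mu -[X in c * X%:R]card_ord mulr_natr -sumr_const.
  by apply: ler_sum => j _.
have mu0 : 0 < mu by exact: lt_le_trans cmu.
have w2 : weighted [seq (1, A ij.1 `&` A ij.2) | ij <- enum {: 'I_n * 'I_n}].
  move=> cc; elim: (enum _) => [|j r IH] //= [<-|/IH] //=.
  by split => //; exact: measurableI.
have w2mu : weighted [seq (2 * mu, A j) | j <- enum 'I_n].
  move=> cc; elim: (enum _) => [|j r IH] //= [<-|/IH] //=.
  by split => //; rewrite mulr_ge0// ltW.
have sum2 (f : set T -> R) : \sum_(cc <- [seq (1, A ij.1 `&` A ij.2) |
    ij <- enum {: 'I_n * 'I_n}]) cc.1 * f cc.2 = \sum_i \sum_j f (A i `&` A j).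
  rewrite big_map big_enum /= pair_big /=.
  by apply: eq_bigr => ij _; rewrite mul1r.
have sum2mu (f : set T -> R) : \sum_(cc <- [seq (2 * mu, A j) | j <- enum 'I_n])
    cc.1 * f cc.2 = 2 * mu * \sum_j f (A j).
  by rewrite big_map big_enum /= -mulr_sumr.
have wL : weighted ((mu ^+ 2 / 4, B) :: [seq (2 * mu, A j) | j <- enum 'I_n]).
  by apply: weighted_cons => //; rewrite divr_ge0// exprn_ge0// ltW.
have wR : weighted ((mu ^+ 2, setT) ::
    [seq (1, A ij.1 `&` A ij.2) | ij <- enum {: 'I_n * 'I_n}]).
  by apply: weighted_cons => //; rewrite exprn_ge0// ltW.
have := weighted_le wL wR (negligible_set0 m).
rewrite !big_cons sum2 sum2mu /= prT mulr1 -/mu => h.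
have {h}main : mu ^+ 2 / 4 * pr B + 2 * mu * mu <=
    mu ^+ 2 + \sum_i \sum_j pr (A i `&` A j).
  apply: h.
  move=> x _; rewrite !big_cons (sum2 (fun B => \1_B x)) (sum2mu (fun B => \1_B x)) /=.
  set N := \sum_j \1_(A j) x.
  have -> : \sum_i \sum_j \1_(A i `&` A j) x = N ^+ 2.
    rewrite expr2 /N mulr_suml; apply: eq_bigr => i _; rewrite mulr_sumr.
    by apply: eq_bigr => j _; rewrite indicI.
  rewrite indicT mulr1 indicE; case: (boolP (_ \in _)).
    rewrite inE /B /= -/N mulr1 => NB.
    have NB2 : N <= mu / 2 by apply: le_trans NB _; lra.
    nra.
  by move=> _; rewrite mulr0 add0r; have := sqr_ge0 (mu - N); nra.
have sq : \sum_i \sum_j pr (A i `&` A j) <= mu + mu ^+ 2.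
  rewrite expr2 /mu mulr_suml -big_split /=; apply: ler_sum => i _.
  rewrite (bigD1 i)//= setIid lerD2l mulr_sumr [leRHS](bigD1 i)//=.
  rewrite ler_wpDl// ?mulr_ge0 ?pr_ge0//.
  by apply: ler_sum => j ij; rewrite indep// eq_sym.
have h4 : mu * pr B <= 4 by nra.
rewrite ler_pdivlMr// mulrC; apply: le_trans h4.
by rewrite ler_wpM2r// pr_ge0.
Qed.

End weighted_indicators.

(** * The particle system on the space of coordinates *)

Definition relevant : set source := [set i | (0 < source_site i)%N].

Section world.
Context {R : realType}.
Local Notation Om := (@coords R source relevant).

Definition hold_of (x : source -> R) (p : particle) (n : nat) : R :=
  x (inl (inr (p, n))).
Definition right_of (x : source -> R) (p : particle) (n : nat) : bool :=
  0 < x (inr (p, n)).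
Definition init_of (x : source -> R) : set particle :=
  [set p | (0 < p.1)%N /\ p.2%:R < x (inl (inl p.1))].
Definition pos_of (x : source -> R) (p : particle) : R -> int :=
  position (hold_of x p) (right_of x p) p.1%:Z.
Definition posl_of (x : source -> R) (p : particle) : R -> int :=
  position_left (hold_of x p) (right_of x p) p.1%:Z.
Definition tau_of x k := dla_tau (init_of x) (pos_of x) (posl_of x) k.
Definition tau_without q x k := dla_tau (init_of x `\ q) (pos_of x) (posl_of x) k.

Lemma measurable_hold p n : (0 < p.1)%N ->
  measurable_fun setT (fun x : Om => hold_of x p n).
Proof. by move=> p1; exact: measurable_coord. Qed.

Lemma discretely_measurable_right p n : (0 < p.1)%N ->
  discretely_measurable (fun x : Om => right_of x p n).
Proof.
move=> p1; apply: discretely_measurable_lt; first exact: measurable_cst.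
exact: (measurable_coord (i := inr (p, n))).
Qed.

Lemma measurable_init p : measurable [set x : Om | init_of x p].
Proof.
have [p0|p1] := posnP p.1.
  rewrite (_ : mkset _ = set0)//; apply/seteqP; split=> x //=.
  by rewrite /init_of /= p0 => -[].
have := discretely_measurable_lt (measurable_cst (p.2%:R : R))
  (measurable_coord (D0 := relevant) (i := inl (inl p.1) : source) p1) true.
rewrite (_ : [set u | _ = true] = [set x : Om | init_of x p])//.
by apply/seteqP; split=> x /=; [split|case].
Qed.

Lemma init_of_gt0 x p : init_of x p -> (0 < p.1)%N.
Proof. by case. Qed.

Lemma measurable_state (I : Om -> set particle) k :
  (forall x p, I x p -> (0 < p.1)%N) -> (forall p, measurable [set x : Om | I x p]) ->
  measurable_fun setT (fun x : Om => dla_tau (I x) (pos_of x) (posl_of x) k) /\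
  forall p, measurable [set x : Om | dla_white (I x) (pos_of x) (posl_of x) k p].
Proof.
move=> I1 mI; exact: (@measurable_dla_state R _ Om I (fun p n x => hold_of x p n)
  (fun p n x => right_of x p n) I1 mI measurable_hold discretely_measurable_right k).
Qed.

Lemma measurable_tau k : measurable_fun setT (fun x : Om => tau_of x k).
Proof. by have [] := measurable_state k init_of_gt0 measurable_init. Qed.

Lemma measurable_white k p :
  measurable [set x : Om | dla_white (init_of x) (pos_of x) (posl_of x) k p].
Proof. by have [_] := measurable_state k init_of_gt0 measurable_init; apply. Qed.

Lemma measurable_tau_without q k : measurable_fun setT (fun x : Om => tau_without q x k).
Proof.
have mi p : measurable [set x : Om | (init_of x `\ q) p].
  rewrite (_ : mkset _ = [set x : Om | init_of x p] `&` [set _ | p <> q]).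
    by apply: measurableI; [exact: measurable_init|exact: measurable_cst_prop].
  by apply/seteqP; split=> x.
have i0 (x : Om) p : (init_of x `\ q) p -> (0 < p.1)%N by case=> /init_of_gt0.
by have [] := measurable_state k i0 mi.
Qed.

Lemma measurable_pos_at_tau q k z : (0 < q.1)%N ->
  measurable [set x : Om | exists2 s, tau_of x k = s%:E & pos_of x q s = z].
Proof.
move=> q1; apply: measurable_position_at.
- by move=> n; exact: measurable_hold.
- by move=> n; exact: discretely_measurable_right.
- exact: measurable_tau.
Qed.

Lemma measurable_posl_at_tau q k z : (0 < q.1)%N ->
  measurable [set x : Om | exists2 s, tau_of x k = s%:E & posl_of x q s = z].
Proof.
move=> q1; apply: measurable_position_left_at.
- by move=> n; exact: measurable_hold.
- by move=> n; exact: discretely_measurable_right.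
- exact: measurable_tau.
Qed.

Definition jumper_of q k (x : source -> R) : Prop :=
  jumper (init_of x) (pos_of x) (posl_of x) q k.

Lemma measurable_jumper q k : (0 < q.1)%N -> measurable [set x : Om | jumper_of q k x].
Proof.
move=> q1.
rewrite (_ : mkset _ =
  [set x : Om | dla_white (init_of x) (pos_of x) (posl_of x) k q] `&`
  ((setT `&` [set x : Om | (tau_of x k < tau_of x k.+1)%E]) `&`
  ([set x : Om | exists2 s, tau_of x k.+1 = s%:E & pos_of x q s = k%:Z] `\`
   [set x : Om | exists2 s, tau_of x k.+1 = s%:E & posl_of x q s = k%:Z]))).
  apply: measurableI; first exact: measurable_white.
  apply: measurableI; first exact: measurable_lte (measurable_tau k) (measurable_tau k.+1).
  by apply: measurableD; [exact: measurable_pos_at_tau|exact: measurable_posl_at_tau].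
apply/seteqP; split=> x /=.
  rewrite /jumper_of /jumper /tau_of; move=> [wq [s ts [ks [Xs Xls]]]].
  split=> //; split; first by rewrite ts.
  split; first by exists s.
  by move=> [s']; rewrite ts => -[<-].
move=> [wq [[_ ks] [[s ts Xs] nl]]]; split=> //; exists s => //.
split; first by rewrite -ts.
by split=> // Xls; apply: nl; exists s.
Qed.

Definition walk_sources (q : particle) : pred source := fun i =>
  match i with
  | inl (inr (p, _)) => p == q
  | inr (p, _) => p == q
  | _ => false
  end.

Lemma mix_same q (x y : Om) :
  hold_of (mix (walk_sources q) (x, y)) q = hold_of y q /\
  right_of (mix (walk_sources q) (x, y)) q = right_of y q.
Proof. by split; apply/funext => n; rewrite /hold_of /right_of /mix /= eqxx. Qed.

Lemma mix_other q p (x y : Om) : p <> q ->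
  hold_of (mix (walk_sources q) (x, y)) p = hold_of x p /\
  right_of (mix (walk_sources q) (x, y)) p = right_of x p.
Proof.
move=> /eqP/negbTE pq.
by split; apply/funext => n; rewrite /hold_of /right_of /mix /= pq.
Qed.

Lemma posl_of_mix q (x y : Om) :
  posl_of (mix (walk_sources q) (x, y)) q = posl_of y q.
Proof. by rewrite /posl_of; have [-> ->] := mix_same q x y. Qed.

(** The walk of [q] is irrelevant to the system without [q]. *)
Lemma tau_without_mix q (x y : Om) k :
  tau_without q (mix (walk_sources q) (x, y)) k = tau_without q x k.
Proof.
rewrite /tau_without -[init_of (mix _ _)]/(init_of x).
apply: (proj1 (dla_state_ext _ _ _)) => p [_ pq].
  by rewrite /pos_of; have [-> ->] := mix_other x y pq.
by rewrite /posl_of; have [-> ->] := mix_other x y pq.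
Qed.

End world.

(** * Almost sure properties of the walks *)

Section exponential_facts.
Context {R : realType}.
Variable D : R.

Lemma exponential_prob_atom r : exponential_prob D [set r] = 0%E.
Proof.
rewrite /exponential_prob null_set_integral//; last exact: lebesgue_measure_set1.
by apply/measurable_EFinP/measurable_funTS; exact: measurable_exponential_pdf.
Qed.

Lemma exponential_prob_lt0 : exponential_prob D [set r | r < 0] = 0%E.
Proof.
rewrite /exponential_prob integral0_eq// => r /= r0.
by rewrite lt0_exponential_pdf.
Qed.

End exponential_facts.

(** The constant [c0] is the probability that a site is occupied. *)
Record dla_model {R : realType} (D c0 : R)
    (PP : probability (@coords R source relevant) R) : Prop := {
  model_independent : product_law PP;
  model_hold : forall (p : particle) n (A : set R), (0 < p.1)%N -> measurable A ->
    PP [set x | A (hold_of x p n)] = exponential_prob D A;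
  model_right : forall (p : particle) n (A : set R), (0 < p.1)%N -> measurable A ->
    PP [set x | A (x (inr (p, n)))] = bernoulli_prob 2^-1 [set b : bool | A b%:R];
  model_count : forall j, (0 < j)%N -> PP [set x | 0 < x (inl (inl j))] = c0%:E }.

Lemma small_power {R : realType} (r e : R) : 0 <= r < 1 -> 0 < e -> exists L, r ^+ L < e.
Proof.
move=> /andP[r0 r1] e0.
have /cvgrPdist_lt/(_ _ e0) : r ^+ n @[n --> \oo] --> (0 : R).
  by apply: cvg_expr; rewrite ger0_norm.
move=> [L _ /(_ L (leqnn L))]; rewrite /= sub0r normrN => h; exists L.
by apply: le_lt_trans h; exact: ler_norm.
Qed.

Section almost_surely.
Context {R : realType}.
Local Notation Om := (@coords R source relevant).
Variables (D c0 : R) (PP : probability Om R).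
Hypotheses (D_gt0 : 0 < D) (model : dla_model D c0 PP).
Let PPP := model_independent model.

Lemma product_null (A : set (Om * Om)) :
  (forall x, PP [set y | A (x, y)] = 0%E) -> (PP \x PP)%E A = 0%E.
Proof.
move=> A0; rewrite /product_measure1 integral0_eq// => x _.
by rewrite -[RHS](A0 x) /=; congr (PP _); apply/seteqP; split => y;
  rewrite /xsection /= inE.
Qed.

Lemma pr_independent c (A B : set Om) : measurable A -> measurable B ->
  (forall x y, A (mix c (x, y)) <-> A x) ->
  (forall x y, B (mix c (x, y)) <-> B y) ->
  pr PP (A `&` B) = pr PP A * pr PP B.
Proof.
move=> mA mB hA hB; transitivity (fine (PP A * PP B)%E).
  by congr fine; exact: (independent_events PPP mA mB hA hB).
by rewrite fineM// fin_num_measure.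
Qed.

Variable q : particle.
Hypothesis q1 : (0 < q.1)%N.

Lemma measurable_jump n : measurable_fun setT (fun x : Om => jump_time (hold_of x q) n).
Proof. by apply: measurable_jump_time => m; exact: measurable_hold. Qed.

Lemma measurable_hold_set n (A : set R) : measurable A ->
  measurable [set x : Om | A (hold_of x q n)].
Proof.
by move=> mA; rewrite -[X in measurable X]setTI; exact: measurable_hold.
Qed.

Lemma hold_gt0_ae : PP.-negligible [set x : Om | exists n, hold_of x q n <= 0].
Proof.
rewrite (_ : mkset _ = \bigcup_n [set x : Om | hold_of x q n <= 0]); last first.
  by apply/seteqP; split=> x [n]; exists n.
apply: negligible_bigcup => n.
rewrite (_ : mkset _ = [set x : Om | hold_of x q n < 0] `|`
    [set x : Om | hold_of x q n = 0]); last first.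
  apply/seteqP; split=> x /=; first by rewrite le_eqVlt => /orP[/eqP|]; [right|left].
  by case=> [/ltW//|->].
have m0 : measurable [set r : R | r < 0].
  by rewrite (_ : mkset _ = `]-oo, 0[%classic)//; apply/seteqP; split=> r /=; rewrite in_itv.
apply: negligibleU.
  apply/negligibleP; first exact: (measurable_hold_set n m0).
  exact: etrans (model_hold model n q1 m0) (exponential_prob_lt0 _).
apply/negligibleP; first exact: (measurable_hold_set n (measurable_set1 0)).
exact: etrans (model_hold model n q1 (measurable_set1 0)) (exponential_prob_atom _ _).
Qed.

Lemma hold_le1_lt1 n : pr PP [set x : Om | hold_of x q n <= 1] <= 1 - expR (- D).
Proof.
have PT : (PP setT <= 1)%E by exact: probability_le1.
have m1 : measurable [set r : R | r <= 1].
  by rewrite (_ : mkset _ = `]-oo, 1]%classic)//; apply/seteqP; split=> r /=; rewrite in_itv.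
have m01 : measurable [set` `[(0:R), 1]] by [].
have e01 : pr PP [set x : Om | `[(0:R), 1]%classic (hold_of x q n)] = 1 - expR (- D).
  transitivity (fine (exponential_prob D `[0, 1])).
    by congr fine; exact: (model_hold model n q1 m01).
  by rewrite exponential_prob_itv0c// mulr1.
rewrite -e01.
apply: (le_trans (union_bound PT
  (A := fun _ : 'I_1 => [set x : Om | `[(0:R), 1]%classic (hold_of x q n)]) _ _ hold_gt0_ae _)).
- by move=> _; exact: measurable_hold_set.
- exact: (measurable_hold_set n m1).
- move=> x /= h1; have [h0|h0] := leP (hold_of x q n) 0; first by left; exists n.
  by right; exists ord0; rewrite in_itv /= h1 ltW.
- by rewrite big_ord1.
Qed.

(** Infinitely many holding times exceed 1, since [L] given ones all stay below with
    a probability that decays geometrically in [L].  This rules out explosions. *)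
Lemma long_holds_ae : PP.-negligible
  [set x : Om | exists a, forall m, (a <= m)%N -> hold_of x q m <= 1].
Proof.
rewrite (_ : mkset _ = \bigcup_a [set x : Om | forall m, (a <= m)%N ->
    hold_of x q m <= 1]); last first.
  by apply/seteqP; split=> x [a]; exists a.
apply: negligible_bigcup => a.
have m1 : measurable [set r : R | r <= 1].
  by rewrite (_ : mkset _ = `]-oo, 1]%classic)//; apply/seteqP; split=> r /=; rewrite in_itv.
have mB : measurable [set x : Om | forall m, (a <= m)%N -> hold_of x q m <= 1].
  apply: (measurable_forall (Q := fun m => [set x : Om | (a <= m)%N -> hold_of x q m <= 1])).
  move=> m; have [am|am] := boolP (a <= m)%N.
    rewrite (_ : mkset _ = [set x : Om | hold_of x q m <= 1]).
      exact: (measurable_hold_set m m1).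
    by apply/seteqP; split=> x /=; [apply|].
  by rewrite (_ : mkset _ = setT)//; apply/seteqP; split.
apply/negligibleP => //.
pose B L := [set x : Om | forall m, (a <= m < a + L)%N -> hold_of x q m <= 1].
have mBL L : measurable (B L).
  apply: (measurable_forall (Q := fun m => [set x : Om | (a <= m < a + L)%N -> hold_of x q m <= 1])).
  move=> m; have [am|am] := boolP (a <= m < a + L)%N.
    rewrite (_ : mkset _ = [set x : Om | hold_of x q m <= 1]).
      exact: (measurable_hold_set m m1).
    by apply/seteqP; split=> x /=; [apply|].
  by rewrite (_ : mkset _ = setT)//; apply/seteqP; split.
have PT : (PP setT <= 1)%E by exact: probability_le1.
have e1 : 0 < expR (- D) by exact: expR_gt0.
have e2 : expR (- D) < 1 by rewrite expR_lt1 oppr_lt0.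
have BL L : pr PP (B L) <= (1 - expR (- D)) ^+ L.
  elim: L => [|L IH]; first by rewrite expr0 pr_le1.
  have -> : B L.+1 = B L `&` [set x : Om | hold_of x q (a + L) <= 1].
    apply/seteqP; split=> x /=.
      move=> h; split; last by apply: h; rewrite leq_addr addnS ltnS leqnn.
      by move=> m /andP[am mL]; apply: h; rewrite am addnS ltnS ltnW.
    move=> [h hL] m /andP[am]; rewrite addnS ltnS leq_eqVlt => /orP[/eqP->//|mL].
    by apply: h; rewrite am.
  have -> : pr PP (B L `&` [set x : Om | hold_of x q (a + L) <= 1]) =
      pr PP (B L) * pr PP [set x : Om | hold_of x q (a + L) <= 1].
    apply: (pr_independent (c := pred1 (inl (inr (q, (a + L)%N)) : source))).
    - exact: mBL.
    - exact: (measurable_hold_set _ m1).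
    - move=> x y; rewrite /B /= /hold_of /mix /=.
      have -> // : (forall m, (a <= m < a + L)%N ->
         (if (inl (inr (q, m)) == inl (inr (q, (a + L)%N)) :> source) then y (inl (inr (q, m))) else x (inl (inr (q, m)))) <= 1) <->
         (forall m, (a <= m < a + L)%N -> x (inl (inr (q, m))) <= 1).
      split=> h m am; have := h m am; rewrite ifF//; apply/negbTE/eqP => -[] e;
      by move: am; rewrite e ltnn andbF.
    - by move=> x y; rewrite /= /hold_of /mix /= eqxx.
  rewrite exprSr ler_pM ?pr_ge0// hold_le1_lt1//.
apply: etrans (prE PT mB) _; congr EFin; apply/eqP; rewrite eq_le pr_ge0 andbT leNgt.
apply/negP => p0.
have [L] : exists L, (1 - expR (- D)) ^+ L <
    pr PP [set x : Om | forall m, (a <= m)%N -> hold_of x q m <= 1].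
  by apply: small_power p0; lra.
rewrite ltNge => /negP; apply.
apply: le_trans (BL L); apply: (pr_le PT mB (mBL L)) => x h m /andP[am _]; exact: h.
Qed.

Lemma jump_unbounded_of (h : nat -> R) : (forall n, 0 < h n) ->
  (forall a, exists2 m, (a <= m)%N & 1 < h m) -> forall T, exists n, T < jump_time h n.
Proof.
move=> h0 h1 T.
suff [n Jn] : exists n, (Num.truncn T).+1%:R <= jump_time h n.
  by exists n; apply: lt_le_trans Jn; exact: Num.Theory.truncnS_gt.
elim: (Num.truncn T).+1 => [|k [n IH]]; first by exists 0%N; rewrite ltW// jump_time_gt0.
have [[//|m] nm hm] := h1 n.+1.
exists m.+1; rewrite jump_timeS -natr1 lerD ?(ltW hm)//.
by apply: le_trans IH _; rewrite jump_time_le.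
Qed.

(** Given all other coordinates, the first holding time would have to take one
    prescribed value. *)
Lemma jump_time_atom n r : PP [set x : Om | jump_time (hold_of x q) n = r] = 0%E.
Proof.
have mA : measurable [set x : Om | jump_time (hold_of x q) n = r].
  by rewrite -[X in measurable X]setTI; exact: (measurable_jump n _ (measurable_set1 r)).
rewrite (resampling PPP (pred1 (inl (inr (q, 0%N)) : source)) mA).
apply: product_null => x.
have -> : [set y | [set xy | [set x : Om | jump_time (hold_of x q) n = r]
      (mix (pred1 (inl (inr (q, 0%N)) : source)) xy)] (x, y)] =
   [set y : Om | [set r - \sum_(m < n) hold_of x q m.+1] (hold_of y q 0)].
  have mixE (y : Om) : jump_time (hold_of (mix (pred1 (inl (inr (q, 0%N)) : source))
      (x, y)) q) n = hold_of y q 0 + \sum_(m < n) hold_of x q m.+1.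
    rewrite /jump_time big_ord_recl; congr (_ + _).
      by rewrite /hold_of /mix /= eqxx.
    apply: eq_bigr => m _; rewrite /hold_of /mix /= ifF//.
    by apply/negbTE/eqP => -[].
  apply/seteqP; split=> y /=; rewrite mixE; first by move=> <-; rewrite addrK.
  by move=> ->; rewrite subrK.
exact: etrans (model_hold model _ q1 (measurable_set1 _)) (exponential_prob_atom _ _).
Qed.

(** The stage times of the system without [q] are independent of the jump times of
    [q], which have no atoms. *)
Lemma jump_neq_tau_ae k n :
  PP.-negligible [set x : Om | tau_without q x k = (jump_time (hold_of x q) n)%:E].
Proof.
have mA : measurable [set x : Om | tau_without q x k = (jump_time (hold_of x q) n)%:E].
  rewrite -[X in measurable X]setTI; apply: measurable_eqe => //.
    exact: measurable_tau_without.
  by apply/measurable_EFinP; exact: measurable_jump.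
apply/negligibleP => //.
apply: etrans (resampling PPP (walk_sources q) mA) _.
apply: product_null => x.
case: (pselect (exists r, tau_without q x k = r%:E)) => [[r e]|ne].
  rewrite -[RHS](jump_time_atom n r); congr (PP _); apply/seteqP.
  split=> y /=; rewrite tau_without_mix e; have [-> _] := mix_same q x y.
    by case.
  by move=> ->.
rewrite (_ : [set y | _] = set0) ?measure0//; apply/seteqP; split=> y //=.
by rewrite tau_without_mix => e; apply: ne; eexists; exact: e.
Qed.

Lemma generic_ae :
  PP.-negligible [set x : Om | ~ generic (init_of x) (hold_of x) (right_of x) q].
Proof.
apply: (@negligibleS _ _ _ _ ([set x : Om | exists n, hold_of x q n <= 0] `|`
   ([set x : Om | exists a, forall m, (a <= m)%N -> hold_of x q m <= 1] `|`
    \bigcup_k \bigcup_n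
      [set x : Om | tau_without q x k = (jump_time (hold_of x q) n)%:E]))).
  move=> x /= ng; apply: contrapT => /not_orP[/forallNP h0 /not_orP[/forallNP h1 h2]].
  have hq n : 0 < hold_of x q n by rewrite ltNge; apply/negP; exact: h0.
  apply: ng; split => //.
    apply: jump_unbounded_of => // a; have /existsNP[m /not_implyP[am /negP]] := h1 a.
    by rewrite -ltNge; exists m.
  by move=> k n e; apply: h2; exists k => //; exists n.
apply: negligibleU; first exact: hold_gt0_ae.
apply: negligibleU; first exact: long_holds_ae.
by do 2 apply: negligible_bigcup => ?; exact: jump_neq_tau_ae.
Qed.

End almost_surely.

(** * Leaders absorbed in the first stages *)

Definition leader (j : nat) : particle := (j.+1, 0%N).

Section decoupling.
Context {R : realType}.
Local Notation Om := (@coords R source relevant).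
Variables (D c0 : R) (PP : probability Om R).
Hypotheses (D_gt0 : 0 < D) (model : dla_model D c0 PP).
Let PPP := model_independent model.
Local Notation PP2 := (PP \x PP)%E.

Lemma product_fibers (A B : set (Om * Om)) :
  (forall x, PP [set y | A (x, y)] = PP [set y | B (x, y)]) -> PP2 A = PP2 B.
Proof.
move=> AB; rewrite /product_measure1; apply: eq_integral => x _ /=.
have e (C : set (Om * Om)) : xsection C x = [set y | C (x, y)].
  by apply/seteqP; split => y; rewrite /xsection /= inE.
by rewrite !e.
Qed.

Lemma product_setT_le1 : (PP2 setT <= 1)%E.
Proof.
rewrite -setXTT [X in (X <= _)%E]product_measure1E//.
by rewrite -[leRHS]mule1 lee_pmul// probability_le1.
Qed.

Lemma product_first (A : set Om) : measurable A -> PP2 (A `*` setT) = PP A.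
Proof.
by move=> mA; rewrite [LHS]product_measure1E// [X in (_ * X)%E]probability_setT mule1.
Qed.

(** Contains the event that [q] is absorbed while another particle ends the stage, and
    involves the walk of [q] only through its position at times independent of it. *)
Definition swept q K : set Om := [set x | exists2 k, (k < K)%N &
  exists2 s, tau_without q x k.+1 = s%:E & posl_of x q s = k.+1%:Z].

Definition jumps_before q K : set Om := [set x | exists2 k, (k < K)%N & jumper_of q k x].

(** The first world keeps all its particles, [q] included; only the ghost of [q]
    comes from the second world. *)
Definition resampled_hit q k : set (Om * Om) :=
  [set xy | exists2 s, tau_of xy.1 k.+1 = s%:E & posl_of xy.2 q s = k.+1%:Z].

Lemma measurable_exists_lt (d : measure_display) (U : measurableType d)
    (Q : nat -> set U) K : (forall k, measurable (Q k)) ->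
  measurable [set u | exists2 k, (k < K)%N & Q k u].
Proof.
move=> mQ; rewrite (_ : mkset _ = [set u | exists k, ([set _ | (k < K)%N] `&` Q k) u]).
  apply: measurable_exists => k; apply: measurableI => //.
  exact: measurable_cst_prop.
by apply/seteqP; split=> u /= [k]; [exists k|case=> ? ?; exists k].
Qed.

Lemma measurable_jumps_before q K : (0 < q.1)%N -> measurable (jumps_before q K).
Proof. by move=> q1; apply: measurable_exists_lt => k; exact: measurable_jumper. Qed.

Lemma measurable_swept q K : (0 < q.1)%N -> measurable (swept q K).
Proof.
move=> q1; apply: measurable_exists_lt => k.
apply: (@measurable_position_left_at _ _ Om (fun n x => hold_of x q n)
  (fun n x => right_of x q n)).
- by move=> n; exact: measurable_hold.
- by move=> n; exact: discretely_measurable_right.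
- exact: measurable_tau_without.
Qed.

Lemma measurable_resampled (p : particle) (x0 z : int) k : (0 < p.1)%N ->
  measurable [set xy : Om * Om | exists2 s, tau_of xy.1 k = s%:E &
    position_left (hold_of xy.2 p) (right_of xy.2 p) x0 s = z].
Proof.
move=> p1; apply: (@measurable_position_left_at _ _ (Om * Om)%type
  (fun n xy => hold_of xy.2 p n) (fun n xy => right_of xy.2 p n)).
- by move=> n; exact: (measurableT_comp (measurable_hold n p1) measurable_snd).
- move=> n v; rewrite (_ : mkset _ = setT `*` [set y : Om | right_of y p n = v]).
    by apply: measurableX => //; exact: discretely_measurable_right.
  by apply/seteqP; split => -[x y] //= [].
- exact: (measurableT_comp (measurable_tau k) measurable_fst).
Qed.

(** Resample the walk of [q].  If [q] ends none of the first [K] stages of the first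
    world, then removing it does not change their times, and the copy of [q] in
    the second world is a ghost for the whole first world. *)
Lemma pr_swept_le q K : (0 < q.1)%N ->
  pr PP (swept q K) <= pr PP (jumps_before q K) + \sum_(k < K) pr PP2 (resampled_hit q k).
Proof.
move=> q1.
(* index 0 is the event that [q] is a jumper, index [k.+1] that its ghost is hit *)
pose A (i : 'I_K.+1) : set (Om * Om) :=
  if unlift ord0 i is Some k then resampled_hit q k else jumps_before q K `*` setT.
have mA i : measurable (A i).
  rewrite /A; case: unliftP => [k _|_]; first exact: measurable_resampled.
  by apply: measurableX => //; exact: measurable_jumps_before.
have -> : pr PP (jumps_before q K) + \sum_(k < K) pr PP2 (resampled_hit q k) =
    \sum_i pr PP2 (A i).
  rewrite big_ord_recl /A unlift_none; congr (_ + _).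
    rewrite /pr; congr fine; apply/esym/product_first.
    exact: measurable_jumps_before.
  by apply: eq_bigr => k _; rewrite liftK.
pose S2 := [set xy | swept q K (mix (walk_sources q) xy)].
have -> : pr PP (swept q K) = pr PP2 S2.
  rewrite /pr; congr fine; exact: (resampling PPP _ (measurable_swept K q1)).
have mS2 : measurable S2.
  by rewrite -[S2]setTI; apply: (measurable_mix (walk_sources q)) => //; exact: measurable_swept.
have [B [mB B0 holdB]] := hold_gt0_ae model q1.
have nB : PP2.-negligible (B `*` setT).
  apply/negligibleP; first exact: measurableX.
  by apply: etrans (product_first mB) _.
apply: (union_bound product_setT_le1 mA mS2 nB) => -[x y] /= [k kK [s]].
rewrite tau_without_mix posl_of_mix => ts Xs.
have [hx|nhx] := pselect (exists n, hold_of x q n <= 0).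
  by left; split=> //; exact: holdB.
right; have [j|nj] := pselect (jumps_before q K x).
  by exists ord0; rewrite /A unlift_none.
exists (lift ord0 (Ordinal kK)); rewrite /A liftK; exists s => //=.
have hq n : 0 < hold_of x q n by rewrite ltNge; apply/negP => h; apply: nhx; exists n.
have [] := never_jumper_unaffected (init := init_of x) (X := pos_of x)
  (Xl := posl_of x) (walker_jumps_listed (right_of x) hq)
  (fun k kK jk => nj (ex_intro2 _ _ k kK jk)) kK.
by rewrite /tau_of => <- _.
Qed.

Definition swap_walk (p p' r : particle) : particle :=
  if r == p then p' else if r == p' then p else r.

Lemma swap_walkK p p' : involutive (swap_walk p p').
Proof.
move=> r; rewrite /swap_walk; case: (eqVneq r p) => [->|rp].
  by case: (eqVneq p' p) => [->//|_]; rewrite eqxx.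
case: (eqVneq r p') => [->|rp']; first by rewrite eqxx.
by rewrite (negbTE rp) (negbTE rp').
Qed.

Definition swap_sources (p p' : particle) (i : source) : source :=
  match i with
  | inl (inr (r, n)) => inl (inr (swap_walk p p' r, n))
  | inr (r, n) => inr (swap_walk p p' r, n)
  | i => i
  end.

Lemma swap_sourcesK p p' : involutive (swap_sources p p').
Proof. by case=> [[x|[r n]]|[r n]] //=; rewrite swap_walkK. Qed.

Lemma swap_walk_gt0 (p p' r : particle) : (0 < p.1)%N -> (0 < p'.1)%N ->
  (0 < r.1)%N -> (0 < (swap_walk p p' r).1)%N.
Proof. by rewrite /swap_walk; case: eqP => [//|_]; case: eqP. Qed.

Lemma walks_identically_distributed (p p' : particle) (A : set Om) :
  (0 < p.1)%N -> (0 < p'.1)%N -> measurable A ->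
  PP A = PP [set x | A (fun i => x (swap_sources p p' i))].
Proof.
move=> p1 p'1 mA; apply: (relabelling PPP) => //.
- exact: inv_inj (swap_sourcesK p p').
- by case=> [[x|[r n]]|[r n]] //= r1; exact: swap_walk_gt0.
- case=> [[x|[r n]]|[r n]] B //= r1 mB.
    have h1 := model_hold model n r1 mB.
    have h2 := model_hold model n (swap_walk_gt0 p1 p'1 r1) mB.
    exact: etrans h2 (esym h1).
  have h1 := model_right model n r1 mB.
  have h2 := model_right model n (swap_walk_gt0 p1 p'1 r1) mB.
  exact: etrans h2 (esym h1).
Qed.

Lemma sum_indic_le1 (T : Type) n (A : 'I_n -> set T) (x : T) :
  (forall i j, A i x -> A j x -> i = j) -> \sum_j (\1_(A j) x : R) <= 1.
Proof.
move=> Ainj; have [[i Ai]|/forallNP nA] := pselect (exists i, A i x).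
  rewrite (bigD1 i)//= big1 ?addr0; first by rewrite indicE mem_set.
  move=> j ji; rewrite indicE memNset// => Aj; move: ji.
  by rewrite (Ainj _ _ Aj Ai) eqxx.
by rewrite big1// => j _; rewrite indicE memNset.
Qed.

(** Let all ghosts share the walk of the first leader, which does not change the law
    of any single one of them.  Started from different sites, they are on different
    sites at all times. *)
Lemma sum_resampled_hit_le1 M k :
  \sum_(j < M) pr PP2 (resampled_hit (leader j) k) <= 1.
Proof.
pose F (j : 'I_M) : set (Om * Om) := [set xy | exists2 s, tau_of xy.1 k.+1 = s%:E &
  position_left (hold_of xy.2 (leader 0)) (right_of xy.2 (leader 0)) j.+1%:Z s = k.+1%:Z].
have -> : \sum_(j < M) pr PP2 (resampled_hit (leader j) k) = \sum_j pr PP2 (F j).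
  apply: eq_bigr => j _; rewrite /pr; congr fine; apply: product_fibers => x.
  have [[s ts]|nts] := pselect (exists s, tau_of x k.+1 = s%:E); last first.
    by congr (PP _); apply/seteqP; split => y /= [s ts]; case: nts; exists s.
  pose A : set Om := [set y | posl_of y (leader j) s = k.+1%:Z].
  have mA : measurable A.
    apply: (@discretely_measurable_position_left _ _ Om
      (fun n y => hold_of y (leader j) n) (fun n y => right_of y (leader j) n)
      _ _ _ (cst s)).
    - by move=> n; exact: measurable_hold.
    - by move=> n; exact: discretely_measurable_right.
    - exact: measurable_cst.
  transitivity (PP A).
    congr (PP _); apply/seteqP; split => y /=; last by move=> ?; exists s.
    by move=> [s']; rewrite ts => -[<-].
  apply: etrans (walks_identically_distributed (p := leader j) (p' := leader 0) _ _ mA) _ => //.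
  have hE (y : Om) : hold_of (fun i => y (swap_sources (leader j) (leader 0) i)) (leader j) =
      hold_of y (leader 0).
    by apply/funext => n; rewrite /hold_of /= /swap_walk eqxx.
  have rE (y : Om) : right_of (fun i => y (swap_sources (leader j) (leader 0) i)) (leader j) =
      right_of y (leader 0).
    by apply/funext => n; rewrite /right_of /= /swap_walk eqxx.
  congr (PP _); apply/seteqP; split => y; rewrite /A /F /= /posl_of hE rE.
    by move=> e; exists s.
  by move=> [s']; rewrite ts => -[<-].
apply: (sum_pr_le product_setT_le1 (Bad := set0)) => //.
- by move=> j; exact: measurable_resampled.
- exact: negligible_set0.
move=> [x y] _; apply: sum_indic_le1 => i j [s ts es] [s' ts' es'].
move: es es'; move: ts' => /=; rewrite ts /= => -[<-].
rewrite /position_left => <- /addIr => -[e].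
by apply: val_inj.
Qed.

Lemma sum_jumps_before_le M K :
  \sum_(j < M) pr PP (jumps_before (leader j) K) <= K%:R.
Proof.
have nB : PP.-negligible (\bigcup_j [set x : Om |
    ~ generic (init_of x) (hold_of x) (right_of x) (leader j)]).
  by apply: negligible_bigcup => j; exact: (generic_ae D_gt0 model).
apply: (sum_pr_le _ _ nB) => //.
- exact: probability_le1.
- by move=> j; exact: measurable_jumps_before.
move=> x gen.
have {}gen j : generic (init_of x) (hold_of x) (right_of x) (leader j).
  by apply: contrapT => h; apply: gen; exists j.
apply: (@le_trans _ _ (\sum_(j < M) \sum_(k < K)
    (\1_([set j : 'I_M | jumper_of (leader j) k x]) j))).
  apply: ler_sum => j _; rewrite indicE.
  case: (boolP (_ \in _)) => [|_]; last by rewrite sumr_ge0.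
  rewrite inE => -[k kK jk]; rewrite (bigD1 (Ordinal kK))//= [X in _ <= X + _]indicE mem_set//.
  by rewrite lerDl sumr_ge0.
rewrite exchange_big /= -[X in _ <= X%:R]card_ord -sum1_card natr_sum.
apply: ler_sum => k _.
apply: (@sum_indic_le1 _ M (fun j => [set x | jumper_of (leader j) k x]) x) => i j ji jj.
have := jumper_unique (gen j) ji jj.
by move=> [e]; apply: val_inj.
Qed.

Lemma sum_swept_le M K : \sum_(j < M) pr PP (swept (leader j) K) <= 2 * K%:R.
Proof.
apply: (@le_trans _ _ (\sum_(j < M) (pr PP (jumps_before (leader j) K) +
    \sum_(k < K) pr PP2 (resampled_hit (leader j) k)))).
  by apply: ler_sum => j _; exact: pr_swept_le.
rewrite big_split /= exchange_big /= mulr_natl mulr2n lerD//.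
  exact: sum_jumps_before_le.
rewrite -[X in _ <= X%:R]card_ord -sum1_card natr_sum.
by apply: ler_sum => k _; exact: sum_resampled_hit_le1.
Qed.

End decoupling.

(** * Leaders visiting the origin *)

Section coin_flips.
Context {R : realType}.

(** Mean of [f] over the [2 ^ n] paths of [n] steps that start at [z]. *)
Fixpoint walk_mean (n : nat) (f : int -> R) (z : int) : R :=
  if n is n'.+1 then (walk_mean n' f (z + 1) + walk_mean n' f (z - 1)) / 2 else f z.

Lemma walk_meanSr n f z : walk_mean n.+1 f z =
  (walk_mean n (fun y => f (y + 1)) z + walk_mean n (fun y => f (y - 1)) z) / 2.
Proof.
elim: n z => [//|n IH] z.
rewrite [LHS]/= -/(walk_mean n.+1 f (z + 1)) -/(walk_mean n.+1 f (z - 1)).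
by rewrite !IH /=; lra.
Qed.

Lemma walk_mean_le n f g z : (forall y, f y <= g y) -> walk_mean n f z <= walk_mean n g z.
Proof. by move=> fg; elim: n z => [|n IH] z //=; have := IH (z + 1); have := IH (z - 1); lra. Qed.

Lemma walk_mean_lin n f g a b z : walk_mean n (fun y => a * f y + b * g y) z =
  a * walk_mean n f z + b * walk_mean n g z.
Proof. by elim: n z => [|n IH] z //=; rewrite !IH; lra. Qed.

Lemma walk_mean_sym n f z : walk_mean n (fun y => f (- y)) z = walk_mean n f (- z).
Proof.
by elim: n z => [|n IH] z //=; rewrite !IH opprD opprB addrC [1 - z]addrC.
Qed.

Lemma walk_mean_cst n (a : R) z : walk_mean n (fun=> a) z = a.
Proof. by elim: n z => [|n IH] z //=; rewrite !IH; lra. Qed.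

Lemma walk_mean2 n z : walk_mean n (fun y => y%:~R ^+ 2) z = z%:~R ^+ 2 + n%:R.
Proof.
elim: n z => [|n IH] z /=; first by rewrite addr0.
by rewrite !IH !rmorphD rmorphN /= -natr1; set y : R := z%:~R; field.
Qed.

Lemma walk_mean4 n z : walk_mean n (fun y => y%:~R ^+ 4) z =
  z%:~R ^+ 4 + 6 * n%:R * z%:~R ^+ 2 + 3 * n%:R ^+ 2 - 2 * n%:R.
Proof.
elim: n z => [|n IH] z /=; first by rewrite !mulr0 expr0n /= !mulr0 mul0r !addr0 subr0.
rewrite !IH !rmorphD rmorphN /= -natr1; set y : R := z%:~R.
set m : R := n%:R; by field.
Qed.

(** By symmetry it is enough to bound the probability that the walk is at distance at
    least [M] from 0 by 1/6.  The quadratic polynomial in the square of the position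
    below lies under the indicator of this event, and its mean follows from the
    second and fourth moments. *)
Lemma walk_mean_spread (M : nat) : (0 < M)%N ->
  12^-1 <= walk_mean (4 * M ^ 2) (fun y => (y <= - M%:Z)%R%:R) 0.
Proof.
move=> M0; set n := (4 * M ^ 2)%N; set g := fun y : int => _.
pose u : R := n%:R.
have uM : u = 4 * M%:R ^+ 2 by rewrite /u /n natrM natrX.
have M1 : 1 <= M%:R :> R by rewrite ler1n.
have u0 : 0 < u by rewrite uM mulr_gt0// exprn_gt0// ltr0n.
have sym : walk_mean n (fun y => g (- y)) 0 = walk_mean n g 0.
  by rewrite walk_mean_sym oppr0.
pose test (y : int) : R := (2 / (3 * u)) * (1 * y%:~R ^+ 2 + (- (6 * u)^-1) * y%:~R ^+ 4) +
   (- 6^-1) * 1.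
have test_le y : test y <= 1 * g y + 1 * g (- y).
  rewrite !mul1r /test mulr1 mul1r.
  set v : R := y%:~R ^+ 2.
  have -> : y%:~R ^+ 4 = v ^+ 2 :> R by rewrite /v -exprM.
  have v0 : 0 <= v by exact: sqr_ge0.
  have -> : (2 / (3 * u)) * (v + - (6 * u)^-1 * v ^+ 2) - 6^-1 =
    (v - v ^+ 2 / (6 * u) - u / 4) * (2 / (3 * u)) by field; rewrite gt_eqF.
  have c0 : 0 < 2 / (3 * u) by rewrite divr_gt0// mulr_gt0.
  have i0 : 0 < (6 * u)^-1 by rewrite invr_gt0 mulr_gt0.
  have [yM|yM] := boolP (`|y| < M%:Z).
    apply: (@le_trans _ _ 0); last by rewrite addr_ge0.
    rewrite pmulr_lle0//.
    have vM : v <= u / 4.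
      rewrite /v uM -[X in X <= _]real_normK ?num_real//.
      have -> : 4 * M%:R ^+ 2 / 4 = M%:R ^+ 2 :> R by field.
      rewrite lerXn2r ?nnegrE ?ler0n//.
      by rewrite -intr_norm -[M%:R]/(M%:Z%:~R) ler_int ltW.
    have : 0 <= v ^+ 2 / (6 * u) by rewrite mulr_ge0 ?sqr_ge0// ltW.
    lra.
  have : 1 <= g y + g (- y).
    rewrite /g; have [h|h] := boolP (y <= - M%:Z); first by rewrite lerDl.
    have [h'|h'] := boolP (- y <= - M%:Z); first by rewrite lerDr.
    by exfalso; move: yM h h'; lia.
  apply: le_trans.
  rewrite -ler_pdivlMr//.
  have -> : 1 / (2 / (3 * u)) = 3 / 2 * u by field; rewrite gt_eqF.
  have : 0 <= (v - 3 * u) ^+ 2 / (6 * u) by rewrite mulr_ge0 ?sqr_ge0// ltW.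
  have -> : (v - 3 * u) ^+ 2 / (6 * u) = v ^+ 2 / (6 * u) - v + 3 / 2 * u.
    by field; rewrite gt_eqF.
  lra.
have := walk_mean_le n 0 test_le.
rewrite walk_mean_lin sym /test walk_mean_lin walk_mean_cst walk_mean_lin.
rewrite walk_mean2 walk_mean4 -/u rmorph0 !expr0n /= mulr0 !add0r !mul1r mulr1.
have -> : 2 / (3 * u) * (u + - (6 * u)^-1 * (3 * u ^+ 2 - 2 * u)) - 6^-1 =
   6^-1 + 2 / (9 * u).
  by field; rewrite gt_eqF.
have : 0 < 2 / (9 * u) by rewrite divr_gt0// mulr_gt0.
lra.
Qed.

End coin_flips.

Section hitting.
Context {R : realType}.
Local Notation Om := (@coords R source relevant).
Variables (D c0 : R) (PP : probability Om R).
Hypotheses (D_gt0 : 0 < D) (model : dla_model D c0 PP).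
Let PPP := model_independent model.
Let PT : (PP setT <= 1)%E.
Proof. exact: probability_le1. Qed.

Lemma pr_setC (B : set Om) : measurable B -> pr PP (~` B) = 1 - pr PP B.
Proof.
move=> mB; transitivity (fine (1 - (pr PP B)%:E)%E); last by [].
congr fine; apply: etrans (probability_setC PP mB) _.
by congr (1 - _)%E; exact: (prE PT mB).
Qed.

Lemma bernoulli_half b : bernoulli_prob (2^-1 : R) [set b] = (2^-1)%:E.
Proof.
rewrite /bernoulli_prob ifT; last by lra.
by rewrite fsbig_set1 /bernoulli_pmf; case: b => //; congr EFin; lra.
Qed.

Section one_walker.
Variable q : particle.
Hypothesis q1 : (0 < q.1)%N.

Lemma pr_right n b : pr PP [set x : Om | right_of x q n = b] = 2^-1.
Proof.
pose A := [set r : R | (0 < r) = b].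
have mA : measurable A.
  rewrite /A; case: (b).
    by rewrite (_ : mkset _ = `]0, +oo[%classic)//; apply/seteqP; split=> r /=; rewrite in_itv /= andbT.
  rewrite (_ : mkset _ = `]-oo, 0]%classic)//; apply/seteqP; split=> r /=;
    by rewrite in_itv /=; case: (ltP 0 r).
have e := model_right model n q1 mA.
transitivity (fine (bernoulli_prob (2^-1 : R) [set b' : bool | A b'%:R])).
  by congr fine; exact: e.
rewrite (_ : mkset _ = [set b]) ?bernoulli_half//.
by apply/seteqP; split=> b' /=; rewrite /A /= ltr0n lt0b.
Qed.

Lemma measurable_walk_after n z (B : set int) :
  measurable [set x : Om | B (walk_after (right_of x q) z n)].
Proof.
apply: (measurable_set_fun (f := fun x : Om => walk_after (right_of x q) z n)).
elim: n => [|n IH].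
  move=> v; rewrite (_ : mkset _ = [set _ | z = v]); first exact: measurable_cst_prop.
  by apply/seteqP; split=> x /=; rewrite /walk_after big_ord0 addr0.
have h := discretely_measurable_comp (fun p : int * int => p.1 + p.2)
  (discretely_measurable_pair IH
    (@discretely_measurable_step _ Om (fun n x => right_of x q n)
      (fun n => discretely_measurable_right n q1) n)).
by move=> v; under eq_set do rewrite walk_afterS; exact: (h v).
Qed.

(** Conditioning on the last step, which is independent of the previous ones. *)
Lemma pr_walk_after n z (B : int -> bool) :
  pr PP [set x : Om | B (walk_after (right_of x q) z n)] =
  walk_mean n (fun y => (B y)%:R) z.
Proof.
elim: n B => [|n IH] B.
  rewrite [RHS]/= (_ : mkset _ = [set _ | B z]); last first.
    by apply/seteqP; split=> x /=; rewrite /walk_after big_ord0 addr0.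
  case: (B z).
    have -> : [set _ : Om | true] = setT by apply/seteqP; split.
    by rewrite /pr [X in fine X]probability_setT.
  have -> : [set _ : Om | false] = set0 by apply/seteqP; split.
  by rewrite /pr measure0.
rewrite walk_meanSr.
rewrite -(IH (fun y => B (y + 1))) -(IH (fun y => B (y - 1))).
set A1 := [set x : Om | B (_ + 1)]; set A2 := [set x : Om | B (_ - 1)].
have mA1 : measurable A1 by exact: (measurable_walk_after n z [set y | B (y + 1)]).
have mA2 : measurable A2 by exact: (measurable_walk_after n z [set y | B (y - 1)]).
pose Rb b := [set x : Om | right_of x q n = b].
have mR b : measurable (Rb b) by exact: discretely_measurable_right.
have -> : [set x : Om | B (walk_after (right_of x q) z n.+1)] =
    (A1 `&` Rb true) `|` (A2 `&` Rb false).
  apply/seteqP; split=> x; rewrite /= walk_afterS /step /A1 /A2 /Rb /=.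
    by case: (right_of x q n) => h; [left|right].
  by case=> -[h ->].
have indep (A : set Om) b (C : set int) : A = [set x : Om | C (walk_after (right_of x q) z n)] ->
    pr PP (A `&` Rb b) = pr PP A * pr PP (Rb b).
  move=> ->; apply: (pr_independent model (c := pred1 (inr (q, n) : source))).
  - exact: measurable_walk_after.
  - exact: mR.
  - move=> x y; rewrite /= (_ : walk_after _ _ _ = walk_after (right_of x q) z n)//.
    rewrite /walk_after; congr (_ + _); apply: eq_bigr => m _.
    rewrite /step (_ : right_of (mix _ _) _ _ = right_of x q m)//.
    rewrite /right_of /mix /= ifF//; apply/negbTE/eqP => -[e].
    by have := ltn_ord m; rewrite e ltnn.
  - by move=> x y; rewrite /Rb /right_of /mix /= eqxx.
have -> : pr PP ((A1 `&` Rb true) `|` (A2 `&` Rb false)) =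
    pr PP (A1 `&` Rb true) + pr PP (A2 `&` Rb false).
  rewrite /pr -fineD ?fin_num_measure//; [|exact: measurableI|exact: measurableI].
  congr fine; apply: measureU; [exact: measurableI|exact: measurableI|].
  by apply/seteqP; split=> x //= [[_ h] [_]]; move: h; rewrite /Rb /= => ->.
rewrite (indep A1 _ [set y | B (y + 1)])// (indep A2 _ [set y | B (y - 1)])//.
by rewrite !pr_right; lra.
Qed.

Lemma pr_walk_low M z : (0 < M)%N -> z <= M%:Z ->
  12^-1 <= pr PP [set x : Om | walk_after (right_of x q) z (4 * M ^ 2) <= 0].
Proof.
move=> M0 zM; apply: le_trans (walk_mean_spread M0) _.
rewrite -pr_walk_after; apply: pr_le => //.
- exact: (measurable_walk_after _ _ [set y | y <= - M%:Z]).
- exact: (measurable_walk_after _ _ [set y | y <= 0]).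
by move=> x; rewrite /walk_after /= add0r => h; rewrite -(lerD2l (- z)) addKr addr0;
  apply: le_trans h _; rewrite lerN2.
Qed.

Lemma pr_hold_gt k m : pr PP [set x : Om | k%:R < hold_of x q m] <= expR (- D) ^+ k.
Proof.
have mA (r : R) : measurable [set x : Om | r < hold_of x q m].
  have m1 : measurable [set s : R | r < s].
    by rewrite (_ : mkset _ = `]r, +oo[%classic)//; apply/seteqP; split=> s /=; rewrite in_itv /= andbT.
  exact: (measurable_hold_set q1 m m1).
case: k => [|k]; first by rewrite expr0 pr_le1.
have m01 : measurable [set` `[(0:R), k.+1%:R]] by [].
pose B := [set x : Om | `[(0:R), k.+1%:R]%classic (hold_of x q m)].
have mB : measurable B by exact: (measurable_hold_set q1 m m01).
have eB : PP B = (1 - (expR (- D) ^+ k.+1)%:E)%E.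
  apply: etrans (model_hold model m q1 m01) _.
  by rewrite exponential_prob_itv0c// mulrC expRM_natl.
apply: (@le_trans _ _ (pr PP (~` B))).
  apply: pr_le => //; first exact: measurableC.
  by move=> x /=; rewrite /B /= in_itv /= => h /andP[_]; rewrite leNgt h.
have -> : pr PP (~` B) = 1 - pr PP B by exact: pr_setC.
have -> : pr PP B = 1 - expR (- D) ^+ k.+1.
  by transitivity (fine (1 - (expR (- D) ^+ k.+1)%:E)%E) => //; congr fine; exact: eB.
by lra.
Qed.

End one_walker.

(** Truncated at [L], to have a finite sum. *)
Lemma layer_cake (h : R) (L : nat) :
  Order.min h L%:R <= \sum_(k < L) \1_[set s : R | k%:R < s] h.
Proof.
elim: L => [|L IH]; first by rewrite big_ord0 ge_min lexx orbT.
rewrite big_ord_recr /= indicE.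
have [Lh|hL] := ltP L%:R h.
  rewrite mem_set// -natr1 ge_min; apply/orP; right; rewrite lerD2r.
  by apply: le_trans IH; rewrite le_min lexx ltW.
rewrite memNset ?addr0; last by apply/negP; rewrite -leNgt.
apply: le_trans IH; rewrite (min_idPl hL) ge_min lexx//.
Qed.

(** Up to an event of probability 1/4, all [n.+1] holding times are below some [L], and
    then their sum is at most the number of pairs [(m, k)] with [k < hold m], whose
    mean is at most [n.+1 / (1 - exp (- D))] by the geometric series, hence at most
    [t / 4]. *)
Lemma pr_jump_time_le q n t : (0 < q.1)%N -> 0 < t ->
  n.+1%:R <= (1 - expR (- D)) * t / 4 ->
  2^-1 <= pr PP [set x : Om | jump_time (hold_of x q) n <= t].
Proof.
move=> q1 t0 nt; set r := expR (- D) in nt *.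
have r0 : 0 < r by exact: expR_gt0.
have r1 : r < 1 by rewrite expR_lt1 oppr_lt0.
have [L rL] : exists L, r ^+ L < (4 * n.+1%:R)^-1.
  by apply: small_power; [lra|rewrite invr_gt0 mulr_gt0].
have mH m k : measurable [set x : Om | k%:R < hold_of x q m].
  have m1 : measurable [set s : R | k%:R < s].
    by rewrite (_ : mkset _ = `]k%:R, +oo[%classic)//; apply/seteqP; split=> s /=; rewrite in_itv /= andbT.
  exact: (measurable_hold_set q1 m m1).
have mJ : measurable [set x : Om | jump_time (hold_of x q) n <= t].
  rewrite -[X in measurable X]setTI; apply: measurable_fun_le => //.
  exact: measurable_jump.
pose A (mk : 'I_n.+1 * 'I_L) := [set x : Om | mk.2%:R < hold_of x q mk.1].
pose big := [set x : Om | t <= \sum_mk \1_(A mk) x].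
have mbig : measurable big by apply: measurable_count_ge => mk; exact: mH.
have geo : \sum_(k < L) r ^+ k <= (1 - r)^-1.
  rewrite -(ler_pM2l (_ : 0 < 1 - r)) ?subr_gt0// mulfV ?subr_eq0 ?gt_eqF//.
  have := subrX1 r L; have := exprn_ge0 L (ltW r0); lra.
have bigL : pr PP big <= 4^-1.
  have h : t * pr PP big <= \sum_mk pr PP (A mk).
    by apply: (markov_count PT) => [mk||]; [exact: mH|exact: mbig|exact: ltW].
  rewrite -(ler_pM2l t0); apply: le_trans h _.
  rewrite -(pair_big xpredT xpredT (fun (m : 'I_n.+1) (k : 'I_L) => pr PP (A (m, k)))) /=.
  apply: (@le_trans _ _ (\sum_(m < n.+1) (1 - r)^-1)).
    apply: ler_sum => m _; apply: le_trans geo; apply: ler_sum => k _.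
    exact: pr_hold_gt.
  rewrite sumr_const card_ord -[X in X <= _]mulr_natl ler_pdivrMr ?subr_gt0//; lra.
(* [None] stands for a large number of pairs, [Some m] for a long holding time *)
pose long (m : 'I_n.+1) := [set x : Om | L%:R < hold_of x q m].
pose C (o : option 'I_n.+1) := if o is Some m then long m else big.
have cover : pr PP (~` [set x : Om | jump_time (hold_of x q) n <= t]) <=
    \sum_o pr PP (C o).
  apply: (union_bound PT (A := C) (Bad := set0)).
  - by case=> [m|]; [exact: mH|exact: mbig].
  - exact: measurableC.
  - exact: negligible_set0.
  move=> x /= /negP; rewrite -ltNge => tJ; right.
  have [[m Lm]|/forallNP short] := pselect (exists m : 'I_n.+1, L%:R < hold_of x q m).
    by exists (Some m).
  exists None; rewrite /C /big /=.
  rewrite -(pair_big xpredT xpredT (fun (m : 'I_n.+1) (k : 'I_L) => \1_(A (m, k)) x)) /=.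
  apply: (le_trans (ltW tJ)); apply: ler_sum => m _.
  have : hold_of x q m <= L%:R by rewrite leNgt; apply/negP; exact: short.
  by move=> /min_idPl {1}<-; exact: layer_cake.
have compl : pr PP (~` [set x : Om | jump_time (hold_of x q) n <= t]) =
    1 - pr PP [set x : Om | jump_time (hold_of x q) n <= t].
  exact: pr_setC.
have longL : \sum_(m < n.+1) pr PP (long m) <= 4^-1.
  apply: (@le_trans _ _ (\sum_(m < n.+1) (4 * n.+1%:R)^-1)).
    by apply: ler_sum => m _; apply: le_trans (ltW rL); exact: pr_hold_gt.
  rewrite sumr_const card_ord -[X in X <= _]mulr_natr invfM -mulrA mulVf ?mulr1//.
move: cover; rewrite compl (bigD1 None)//= (reindex_omap Some id)/=; last by case.
under eq_bigl do rewrite eqxx.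
rewrite /C; lra.
Qed.

End hitting.

(** * Tail of the stage times *)

Section stage_times.
Context {R : realType}.
Local Notation Om := (@coords R source relevant).
Variables (D c0 : R) (PP : probability Om R).
Hypotheses (D_gt0 : 0 < D) (c0_gt0 : 0 < c0) (model : dla_model D c0 PP).
Let PPP := model_independent model.
Let PT : (PP setT <= 1)%E.
Proof. exact: probability_le1. Qed.

(** The number [4 * M ^ 2] of steps makes the standard deviation of the walk [2 * M];
    the last of these steps is taken at the jump time of index [(4 * M ^ 2).-1]. *)
Definition early_jumps (M : nat) (t : R) (j : nat) : set Om :=
  [set x | jump_time (hold_of x (leader j)) (4 * M ^ 2).-1 <= t].
Definition low_walk (M j : nat) : set Om :=
  [set x | walk_after (right_of x (leader j)) j.+1%:Z (4 * M ^ 2) <= 0].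
Definition reaches_origin M t j : set Om :=
  [set x : Om | init_of x (leader j)] `&` early_jumps M t j `&` low_walk M j.

Lemma measurable_early_jumps M t j : measurable (early_jumps M t j).
Proof.
rewrite -[early_jumps _ _ _]setTI; apply: measurable_fun_le => //.
exact: measurable_jump.
Qed.

Lemma measurable_low_walk M j : measurable (low_walk M j).
Proof. exact: (@measurable_walk_after _ (leader j) _ _ _ [set y | y <= 0]). Qed.

Lemma measurable_reaches_origin M t j : measurable (reaches_origin M t j).
Proof.
apply: measurableI; last exact: measurable_low_walk.
by apply: measurableI; [exact: measurable_init|exact: measurable_early_jumps].
Qed.

Lemma pr_reaches_origin M t j : (0 < M)%N -> (j < M)%N -> 0 < t ->
  (4 * M ^ 2)%:R <= (1 - expR (- D)) * t / 4 ->
  c0 / 24 <= pr PP (reaches_origin M t j).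
Proof.
move=> M0 jM t0 Mt.
(* the occupation of the site, the holding times and the directions are three
   independent blocks of coordinates *)
pose crgt : pred source := fun i => if i is inr _ then true else false.
pose chold : pred source := fun i => if i is inl (inr _) then true else false.
have -> : pr PP (reaches_origin M t j) =
   pr PP ([set x : Om | init_of x (leader j)] `&` early_jumps M t j) * pr PP (low_walk M j).
  apply: (pr_independent model (c := crgt)) => //.
  - by apply: measurableI; [exact: measurable_init|exact: measurable_early_jumps].
  - exact: measurable_low_walk.
have -> : pr PP ([set x : Om | init_of x (leader j)] `&` early_jumps M t j) =
   pr PP [set x : Om | init_of x (leader j)] * pr PP (early_jumps M t j).
  apply: (pr_independent model (c := chold)) => //.
  - exact: measurable_init.
  - exact: measurable_early_jumps.
have -> : pr PP [set x : Om | init_of x (leader j)] = c0.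
  transitivity (fine c0%:E) => //; rewrite -(model_count model (ltn0Sn j)) /pr.
  by congr (fine (PP _)); apply/seteqP; split=> x /=; rewrite /init_of /=; [case|].
have h1 : 2^-1 <= pr PP (early_jumps M t j).
  apply: (pr_jump_time_le D_gt0 model) => //.
  by rewrite prednK// muln_gt0 expn_gt0 M0.
have h2 : 12^-1 <= pr PP (low_walk M j).
  exact: (pr_walk_low model).
rewrite -mulrA ler_pM2l//.
apply: (@le_trans _ _ (2^-1 * 12^-1)); first lra.
by apply: ler_pM.
Qed.

Definition site_sources (j : nat) : pred source := fun i =>
  match i with
  | inl (inl x) => x == j.+1
  | _ => walk_sources (leader j) i
  end.

Lemma reaches_origin_mix M t j (x y : Om) :
  reaches_origin M t j (mix (site_sources j) (x, y)) <-> reaches_origin M t j y.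
Proof.
have h : hold_of (mix (site_sources j) (x, y)) (leader j) = hold_of y (leader j).
  by apply/funext => n; rewrite /hold_of /mix /= eqxx.
have r : right_of (mix (site_sources j) (x, y)) (leader j) = right_of y (leader j).
  by apply/funext => n; rewrite /right_of /mix /= eqxx.
have i : init_of (mix (site_sources j) (x, y)) (leader j) = init_of y (leader j).
  by rewrite /init_of /mix /= eqxx.
by rewrite /reaches_origin /early_jumps /low_walk /= h r i.
Qed.

Lemma reaches_origin_mix_other M t i j (x y : Om) : i <> j ->
  reaches_origin M t i (mix (site_sources j) (x, y)) <-> reaches_origin M t i x.
Proof.
move=> ij.
have lij : (leader i == leader j) = false by apply/negbTE/eqP => -[].
have h : hold_of (mix (site_sources j) (x, y)) (leader i) = hold_of x (leader i).
  by apply/funext => n; rewrite /hold_of /mix /= lij.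
have r : right_of (mix (site_sources j) (x, y)) (leader i) = right_of x (leader i).
  by apply/funext => n; rewrite /right_of /mix /= lij.
have e : init_of (mix (site_sources j) (x, y)) (leader i) = init_of x (leader i).
  by rewrite /init_of /mix /= eqSS (_ : (i == j) = false)//; apply/negbTE/eqP.
by rewrite /reaches_origin /early_jumps /low_walk /= h r e.
Qed.

Lemma reaches_origin_absorbed M t K j (x : Om) : (0 < M)%N ->
  generic (init_of x) (hold_of x) (right_of x) (leader j) ->
  (t%:E < tau_of x K)%E -> reaches_origin M t j x ->
  jumps_before (leader j) K x \/ swept (leader j) K x.
Proof.
move=> M0 gen tK [[ix Jt] low]; have [_ hq _ _] := gen.
apply: absorbedP => //.
apply: (nonpositive_absorbed gen (u := jump_time (hold_of x (leader j)) (4 * M ^ 2).-1)).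
- exact/ltW/jump_time_gt0.
- by apply: le_lt_trans tK; rewrite lee_fin.
- by rewrite position_at_jump// prednK// muln_gt0 expn_gt0 M0.
Qed.

(** If stage [K] is not over at time [t], every leader that visits the origin by then
    has been a jumper or has been swept.  Either few leaders visit the origin,
    which is unlikely by Chebyshev's inequality, or many leaders are jumpers or swept,
    while on average at most [3 * K] are. *)
Lemma pr_tau_gt M t K : (0 < M)%N -> 0 < t ->
  (4 * M ^ 2)%:R <= (1 - expR (- D)) * t / 4 ->
  pr PP [set x : Om | (t%:E < tau_of x K)%E] <=
    (4 + 6 * K%:R) / (c0 / 24 * M%:R).
Proof.
move=> M0 t0 Mt; set c := c0 / 24.
have c_gt0 : 0 < c by rewrite divr_gt0.
have M1 : 0 < M%:R :> R by rewrite ltr0n.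
have nB : PP.-negligible (\bigcup_j [set x : Om |
    ~ generic (init_of x) (hold_of x) (right_of x) (leader j)]).
  by apply: negligible_bigcup => j; exact: (generic_ae D_gt0 model).
pose few := [set x : Om | \sum_(j < M) \1_(reaches_origin M t j) x <= c * M%:R / 2].
pose A (o : 'I_M + 'I_M) : set Om := match o with
  | inl j => jumps_before (leader j) K
  | inr j => swept (leader j) K end.
have mA o : measurable (A o).
  by case: o => j; [exact: measurable_jumps_before|exact: measurable_swept].
pose many := [set x : Om | c * M%:R / 2 <= \sum_o \1_(A o) x].
have mfew : measurable few.
  by apply: measurable_count_le => j; exact: measurable_reaches_origin.
have mmany : measurable many by exact: measurable_count_ge.
have few_le : pr PP few <= 4 / (c * M%:R).
  apply: (chebyshev_count PT) => //.
  - by move=> j; exact: measurable_reaches_origin.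
  - by rewrite /pr [X in fine X]probability_setT.
  - move=> i j ij; apply: (pr_independent model (c := site_sources j)).
    + exact: measurable_reaches_origin.
    + exact: measurable_reaches_origin.
    + move=> x y; apply: reaches_origin_mix_other => e.
      by move: ij; rewrite (val_inj e) eqxx.
    + by move=> x y; exact: reaches_origin_mix.
  - by move=> j; exact: pr_reaches_origin.
have many_le : pr PP many <= 6 * K%:R / (c * M%:R).
  have := markov_count PT mA mmany (ltW (divr_gt0 (mulr_gt0 c_gt0 M1) (ltr0n _ 2))).
  rewrite big_sumType /= -/many => h.
  have h3 : c * M%:R / 2 * pr PP many <= 3 * K%:R.
    apply: le_trans h _; rewrite (_ : 3 * K%:R = K%:R + 2 * K%:R :> R); last by lra.
    apply: lerD; first exact: (sum_jumps_before_le D_gt0 model).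
    exact: (sum_swept_le D_gt0 model).
  rewrite ler_pdivlMr ?mulr_gt0//; lra.
have mlate : measurable [set x : Om | (t%:E < tau_of x K)%E].
  rewrite -[X in measurable X]setTI; apply: measurable_lte => //.
  exact: measurable_tau.
apply: (@le_trans _ _ (pr PP few + pr PP many)); last first.
  by rewrite mulrDl lerD.
have -> : pr PP few + pr PP many = \sum_(b : bool) pr PP (if b then few else many).
  by rewrite big_bool.
apply: (union_bound PT _ mlate nB); first by case.
move=> x tK; have [bad|gen] := pselect ((\bigcup_j [set x : Om |
    ~ generic (init_of x) (hold_of x) (right_of x) (leader j)]) x); first by left.
right; have [xfew|nfew] := pselect (few x); first by exists true.
exists false; rewrite /many /=.
have {nfew} : c * M%:R / 2 < \sum_(j < M) \1_(reaches_origin M t j) x.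
  by rewrite ltNge; apply/negP.
move=> /ltW/le_trans; apply; rewrite big_sumType /= -big_split /=.
apply: ler_sum => j _; rewrite [X in X <= _]indicE.
case: (boolP (_ \in _)) => [|_]; last by rewrite addr_ge0.
rewrite inE => hit.
have gj : generic (init_of x) (hold_of x) (right_of x) (leader j).
  by apply: contrapT => h; apply: gen; exists j.
case: (reaches_origin_absorbed M0 gj tK hit) => h.
  by rewrite [X in _ <= X + _]indicE mem_set// lerDl.
by rewrite [X in _ <= _ + X]indicE mem_set// lerDr.
Qed.

End stage_times.

(** * The law of the random inputs, and the growth of the aggregate *)

Section canonical_world.
Context {R : realType} d (T : measurableType d) (P : probability T R).
Local Notation Om := (@coords R source relevant).
Variables (N : nat -> {RV P >-> nat}) (hold : particle -> nat -> {RV P >-> R})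
  (right : particle -> nat -> {RV P >-> bool}).

Definition world_of (w : T) : Om := fun i =>
  match i with
  | inl (inl x) => (N x w)%:R
  | inl (inr (p, n)) => hold p n w
  | inr (p, n) => (right p n w)%:R
  end.

Lemma measurable_world_of : measurable_fun setT world_of.
Proof.
apply: measurable_coords => -[[x|[p n]]|[p n]] _ /=.
- by apply: (measurableT_comp (f := fun m : nat => m%:R : R)) => // _ B _.
- exact: measurable_funPT.
- by apply: (measurableT_comp (f := fun b : bool => b%:R : R)) => // _ B _.
Qed.

HB.instance Definition _ :=
  isMeasurableFun.Build _ _ T Om world_of measurable_world_of.

Definition world_law : probability Om R := distribution P world_of.

Lemma dla_process_world t w : dla_process N hold right t w =
  dla_R (init_of (world_of w)) (pos_of (world_of w)) (posl_of (world_of w)) t.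
Proof.
rewrite /dla_process.
have -> : init_of (world_of w) = [set p | (0 < p.1)%N /\ (p.2 < N p.1 w)%N].
  by apply/seteqP; split=> p; rewrite /init_of /= ltr_nat.
have rE p : right_of (world_of w) p = right p ^~ w.
  by apply/funext => n; rewrite /right_of /= ltr0n lt0b.
rewrite (_ : pos_of (world_of w) = fun p => position (hold p ^~ w) (right p ^~ w) p.1%:Z).
  rewrite (_ : posl_of (world_of w) = fun p => position_left (hold p ^~ w) (right p ^~ w) p.1%:Z)//.
  by apply/funext => p; rewrite /posl_of rE.
by apply/funext => p; rewrite /pos_of rE.
Qed.

Hypothesis sources_independent :
  mutually_independent P [set i : source | (0 < source_site i)%N]
    (source_sigma N hold right).

Lemma world_product_law : product_law world_law.
Proof.
move=> s A sD mA.
have -> : world_law (cylinder s A) = P (\bigcap_(i in [set` s]) (world_of ^~ i) @^-1` A i).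
  by congr (P _); apply/seteqP; split=> w h i; exact: h.
rewrite sources_independent//.
move=> [[x|[p n]]|[p n]] _ /=; rewrite /sigma_of /preimage_set_system /=.
- by exists [set m | A (inl (inl x)) m%:R] => //; rewrite setTI.
- by exists (A (inl (inr (p, n)))) => //; rewrite setTI.
- by exists [set b : bool | A (inr (p, n)) b%:R] => //; rewrite setTI.
Qed.

Variables (D mu2 : R).
Hypothesis hold_exponential : forall (p : particle) (n : nat), (0 < p.1)%N ->
  forall A : set R, measurable A -> distribution P (hold p n) A = exponential_prob D A.
Hypothesis right_fair : forall (p : particle) (n : nat), (0 < p.1)%N ->
  forall A : set bool, distribution P (right p n) A = bernoulli_prob (2^-1) A.
Hypothesis N_identically_distributed : forall i j : nat, (0 < i)%N -> (0 < j)%N ->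
  forall A : set nat, distribution P (N i) A = distribution P (N j) A.
Hypothesis N_second_moment : forall i : nat, (0 < i)%N ->
  ('E_P[fun w => ((N i w)%:R ^+ 2)%R] = mu2%:E)%E.
Hypothesis mu2_gt0 : 0 < mu2.

Lemma occupied_gt0 : 0 < fine (P [set w | (0 < N 1 w)%N]).
Proof.
have mA : measurable [set w | (0 < N 1 w)%N].
  have := @measurable_funPTI _ _ _ _ (N 1) [set m | (0 < m)%N] I.
  by [].
rewrite lt0r fine_ge0// andbT; apply/negP => /eqP P0.
have PA0 : P [set w | (0 < N 1 w)%N] = 0%E.
  by rewrite -[LHS]fineK ?fin_num_measure// P0.
have := N_second_moment (ltn0Sn 0); rewrite unlock.
rewrite (ae_eq_integral (cst 0%E))//.
- by rewrite integral_cst// mul0e => -[e]; move: mu2_gt0; rewrite -e ltxx.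
- apply/measurable_EFinP.
  by apply: (measurableT_comp (f := fun m : nat => m%:R ^+ 2 : R)) => // _ B _.
- exists [set w | (0 < N 1 w)%N]; split=> // w /= h; rewrite lt0n.
  by apply/negP => /eqP e; apply: h => _; rewrite e expr0n.
Qed.

Lemma world_model : dla_model D (fine (P [set w | (0 < N 1 w)%N])) world_law.
Proof.
split.
- exact: world_product_law.
- move=> p n A p1 mA; exact: etrans _ (hold_exponential n p1 mA).
- move=> p n A p1 mA; exact: etrans _ (right_fair n p1 _).
- move=> j j1; rewrite fineK ?fin_num_measure//; last first.
    exact: (@measurable_funPTI _ _ _ _ (N 1) [set m | (0 < m)%N] I).
  transitivity (distribution P (N j) [set m | (0 < m)%N]).
    by congr (P _); apply/seteqP; split=> w /=; rewrite ltr0n.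
  by rewrite (N_identically_distributed j1 (ltn0Sn 0)).
Qed.

End canonical_world.

(** The stage times are nondecreasing, so that exceeding a level means having
    completed the first stage whose index exceeds it. *)
Lemma dla_R_gt {R : realType} (init : set particle) (X Xl : particle -> R -> int)
    (t eta : R) : 0 < t -> 0 < eta ->
  (eta%:E < dla_R init X Xl t / (Num.sqrt t)%:E)%E <->
  (dla_tau init X Xl (Num.truncn (eta * Num.sqrt t)).+1 <= t%:E)%E.
Proof.
move=> t0 eta0; have s0 : 0 < Num.sqrt t by rewrite sqrtr_gt0.
have es0 : 0 <= eta * Num.sqrt t by rewrite mulr_ge0// ltW.
rewrite inver gt_eqF// lte_pdivlMr// -EFinM; split.
  move=> /ereal_sup_gt[_ [k /= kt <-]]; rewrite lte_fin -truncn_lt_nat// => Kk.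
  by apply: le_trans kt; exact: dla_tau_nondecreasing.
move=> Kt; apply: (@lt_le_trans _ _ ((Num.truncn (eta * Num.sqrt t)).+1%:R)%:E).
  by rewrite lte_fin truncnS_gt.
by apply: ereal_sup_ubound; exists (Num.truncn (eta * Num.sqrt t)).+1.
Qed.

(** The length [M] is of order [b * s] and the number of stages of order [eta * s].
    Choosing [eta] proportional to [c * eps] makes the stages responsible for half
    of [eps], and the remaining half absorbs [4 / (c * M)] for large [s]. *)
Lemma parameter_choice {R : realType} (c b eps : R) : 0 < c -> 0 < b -> 0 < eps ->
  exists2 eta : R, 0 < eta & exists2 S : R, 0 < S &
    forall s, S <= s -> let M := Num.truncn (b * s) in
      (0 < M)%N /\
      (4 + 6 * (Num.truncn (eta * s)).+1%:R) / (c * M%:R) <= eps.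
Proof.
move=> c0 b0 eps0; pose kap := c * eps / 12.
have kap0 : 0 < kap by rewrite divr_gt0// mulr_gt0.
have ce0 : 0 < c * eps by exact: mulr_gt0.
exists (kap * b / 2); first by rewrite divr_gt0// mulr_gt0.
(* above [S1], rounding [eta * s] up to an integer is harmless; above [S2], the
   length [M] exceeds [8 / (c * eps)] *)
pose S1 := 2 * (1 + kap) / (kap * b); pose S2 := (8 / (c * eps) + 1) / b.
have S10 : 0 < S1 by rewrite divr_gt0 ?mulr_gt0// ltr_wpDr// ltW.
have S20 : 0 < S2 by rewrite divr_gt0// ltr_wpDl// divr_ge0// ltW.
exists (S1 + S2); first by exact: addr_gt0.
move=> s Ss M.
have s0 : 0 < s by lra.
have bs0 : 0 <= b * s by rewrite mulr_ge0// ltW.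
have /andP[Mle Mgt] := truncn_itv bs0.
rewrite -/M in Mle Mgt.
have h1 : 2 * (1 + kap) <= kap * b * s.
  by rewrite [X in _ <= X]mulrC -ler_pdivrMr ?mulr_gt0// -/S1; lra.
have h2 : 8 / (c * eps) + 1 <= b * s.
  by rewrite [X in _ <= X]mulrC -ler_pdivrMr// -/S2; lra.
have M1 : 8 / (c * eps) < M%:R by move: Mgt; rewrite -natr1; lra.
have M0 : 0 < M%:R :> R by apply: lt_trans M1; rewrite divr_gt0.
split; first by rewrite ltr0n in M0.
have es0 : 0 <= kap * b / 2 * s.
  by rewrite mulr_ge0// ?ltW// divr_gt0// mulr_gt0.
have /andP[Kle _] := truncn_itv es0.
set m := Num.truncn (kap * b / 2 * s) in Kle *.
have KM : m.+1%:R <= kap * M%:R.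
  have : kap * (b * s - 1) <= kap * M%:R.
    by rewrite ler_pM2l//; move: Mgt; rewrite -natr1; lra.
  by rewrite -[m.+1%:R]natr1; lra.
have M8 : 8 < M%:R * (c * eps) by rewrite -ltr_pdivrMr.
rewrite ler_pdivrMr ?mulr_gt0//.
by move: KM; rewrite /kap; lra.
Qed.

Unset Implicit Arguments.

Theorem theorem3 (R : realType) (d : measure_display) (T : measurableType d)
    (P : probability T R) (D mu2 : R)
    (N : nat -> {RV P >-> nat})
    (hold : particle -> nat -> {RV P >-> R})
    (right : particle -> nat -> {RV P >-> bool})
    (D_gt0 : 0 < D)
    (sources_independent :
      mutually_independent P [set i : source | (0 < source_site i)%N]
        (source_sigma N hold right))
    (hold_exponential : forall (p : particle) (n : nat), (0 < p.1)%N ->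
      forall A : set R, measurable A ->
        distribution P (hold p n) A = exponential_prob D A)
    (right_fair : forall (p : particle) (n : nat), (0 < p.1)%N ->
      forall A : set bool,
        distribution P (right p n) A = bernoulli_prob (2^-1) A)
    (N_identically_distributed : forall i j : nat, (0 < i)%N -> (0 < j)%N ->
      forall A : set nat, distribution P (N i) A = distribution P (N j) A)
    (N_second_moment : forall i : nat, (0 < i)%N ->
      ('E_P[fun w => ((N i w)%:R ^+ 2)%R] = mu2%:E)%E)
    (mu2_gt0 : 0 < mu2) :
  forall eps : R, 0 < eps ->
  exists2 eta : R, 0 < eta &
  exists t0 : R, forall t : R, t0 <= t ->
    (P [set w | dla_process N hold right t w / (Num.sqrt t)%:E > eta%:E]
       >= (1 - eps)%:E)%E.
Proof.
have model := world_model sources_independent hold_exponential right_fair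
  N_identically_distributed.
have occ := occupied_gt0 N_second_moment mu2_gt0.
set c0 := fine _ in occ model.
move=> eps eps0.
have e1 : expR (- D) < 1 by rewrite expR_lt1 oppr_lt0.
pose b := Num.sqrt (1 - expR (- D)) / 4.
have b0 : 0 < b by rewrite divr_gt0// sqrtr_gt0 subr_gt0.
have [eta eta0 [S S0 choice]] := parameter_choice (divr_gt0 occ (ltr0n _ 24)) b0 eps0.
exists eta => //; exists (S ^+ 2) => t St.
have t0 : 0 < t by apply: lt_le_trans St; rewrite exprn_gt0.
have Ss : S <= Num.sqrt t.
  by rewrite -(ger0_norm (ltW S0)) -sqrtr_sqr; exact: ler_wsqrtr.
have [M0 Mbound] := choice _ Ss.
set M := Num.truncn _ in M0 Mbound; set K := (Num.truncn _).+1 in Mbound.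
have Mt : (4 * M ^ 2)%:R <= (1 - expR (- D)) * t / 4.
  have bs0 : 0 <= b * Num.sqrt t by rewrite mulr_ge0 ?sqrtr_ge0// ltW.
  have /andP[Mle _] := truncn_itv bs0.
  have : M%:R ^+ 2 <= (b * Num.sqrt t) ^+ 2 by rewrite lerXn2r ?nnegrE ?ler0n.
  rewrite exprMn /b expr_div_n !sqr_sqrtr ?(ltW t0) ?subr_ge0 ?(ltW e1)//.
  by rewrite natrM natrX; lra.
have late := le_trans (pr_tau_gt D_gt0 occ model K M0 t0 Mt) Mbound.
have -> : [set w | (dla_process N hold right t w / (Num.sqrt t)%:E > eta%:E)%E] =
    world_of N hold right @^-1` (~` [set x | (t%:E < tau_of x K)%E]).
  apply/seteqP; split=> w /=; rewrite dla_process_world.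
    by move/(dla_R_gt _ _ _ t0 eta0)/le_gtF => ->.
  by move/negP; rewrite -leNgt => ?; apply/(dla_R_gt _ _ _ t0 eta0).
have mlate : measurable [set x : coords relevant | (t%:E < tau_of x K)%E].
  rewrite -[X in measurable X]setTI; apply: measurable_lte => //.
  exact: measurable_tau.
change ((1 - eps)%:E <= world_law N hold right (~` [set x | (t%:E < tau_of x K)%E]))%E.
rewrite (prE (probability_le1 _ measurableT))//; last exact: measurableC.
by rewrite lee_fin pr_setC//; lra.
Qed.
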